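(* Let $E$ be an equivalence relation on $2^\omega$. Then $E$ is infinite time enumerable if and only if there exists a countable group $\Gamma$ (under composition) of infinite time computable bijections of $2^\omega$ such that $E$ equals the orbit equivalence relation $E_\Gamma$. Analogously, $E$ is infinite time eventually enumerable if and only if there exists a countable group $\Gamma$ of infinite time eventually computable bijections of $2^\omega$ such that $E=E_\Gamma$.
   Context: Infinite time Turing machines: tapes of $\omega$ cells with values $0/1$ (input, work, output, optionally a parameter tape with a real), a finite program, successor steps as for ordinary Turing machines; at limit stages the head moves to the leftmost cell, the state becomes a special limit state, and each cell takes the $\limsup$ of its earlier values; halting only upon reaching the halt state. A function $f\colon2^\omega\to2^\omega$ is infinite time computable if some program with some real parameter halts on each input $x$ with output $f(x)$; it is infinite time eventually computable if some program with some real parameter has, on each input $x$, output tape that from some ordinal stage onward permanently shows $f(x)$. An equivalence relation $E$ on $2^\omega$ (with countable classes) is infinite time enumerable (resp. eventually enumerable) if there is an infinite time computable (resp. eventually computable) function $f$ such that for every $x$, $f(x)$ codes (via a fixed pairing of $\omega\times\omega$ with $\omega$) a sequence $\langle x_0,x_1,\dots\rangle$ with $\{x_n:n\in\omega\}=[x]_E$. For a group $\Gamma$ of bijections of $2^\omega$, $x\mathrel{E_\Gamma}y$ iff $\gamma x=y$ for some $\gamma\in\Gamma$. *)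

(* Defs.v *)
From Stdlib Require Cantor.
From Stdlib Require Export RelationClasses.
From mathcomp Require Export all_boot.
From mathcomp Require Export boolp classical_sets cardinality.

Set Implicit Arguments.
Unset Strict Implicit.
Unset Printing Implicit Defensive.

Local Open Scope classical_set_scope.

(** * Ordinals *)

(* [osup A f] denotes the least ordinal strictly above all the [f i].  Trees
   are not unique representatives of ordinals: order-theoretic statements are
   made with [ole] and [olt], never with Leibniz equality.  Branching over
   arbitrary types gives ordinals far beyond omega_1. *)
Inductive Ord : Type := osup (A : Type) (f : A -> Ord).

Fixpoint ole (a b : Ord) {struct a} : Prop :=
  match a, b with
  | osup A f, osup B g => forall i : A, exists j : B, ole (f i) (g j)
  end.

Definition olt (a b : Ord) : Prop :=
  match b with osup B g => exists j : B, ole a (g j) end.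

Definition is_ozero (a : Ord) : Prop := forall b, ~ olt b a.

Definition is_osucc (b a : Ord) : Prop :=
  olt b a /\ forall c, olt c a -> ole c b.

Definition is_olimit (a : Ord) : Prop :=
  (exists b, olt b a) /\
  (forall b, olt b a -> exists c, olt b c /\ olt c a).

Lemma ole_refl a : ole a a.
Proof. by elim: a => A f IH /= i; exists i; exact: IH. Qed.

Lemma ole_trans b a c : ole a b -> ole b c -> ole a c.
Proof.
elim: a b c => A f IH [B g] [C h] /= ab bc i.
by have [j ij] := ab i; have [k jk] := bc j; exists k; apply: IH ij jk.
Qed.

Lemma ole_olt_trans b a c : ole a b -> olt b c -> olt a c.
Proof. by case: c => C h ab [k bk]; exists k; apply: ole_trans ab bk. Qed.

Lemma oltP a b : ole a b <-> forall c, olt c a -> olt c b.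
Proof.
case: a b => A f [B g]; split=> [ab c [i ci]|H i].
  by have [j ij] := ab i; exists j; apply: ole_trans ci ij.
by apply: (H (f i)); exists i; apply: ole_refl.
Qed.

Lemma oltW a b : olt a b -> ole a b.
Proof.
elim: b a => B g IH a [j aj]; apply/oltP => c ca.
have := (oltP a (g j)).1 aj c ca => cj.
by exists j; apply: IH.
Qed.

Lemma olt_ole_trans b a c : olt a b -> ole b c -> olt a c.
Proof. by move=> ab /oltP; apply. Qed.

Lemma olt_wf : well_founded olt.
Proof.
suff H a b : ole b a -> Acc olt b by move=> a; exact: H (ole_refl a).
elim: a b => A f IH b ba; constructor=> c cb.
have : olt c (osup f) := olt_ole_trans cb ba.
by move=> [i]; apply: IH.
Qed.

Lemma olt_irr a : ~ olt a a.
Proof. by elim/(well_founded_ind olt_wf): a => a IH aa; exact: (IH a aa aa). Qed.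


Lemma ole_total a b : ole a b \/ olt b a.
Proof.
elim/(well_founded_ind olt_wf): a b => a IH b.
have [[c [ca bc]]|nh] := pselect (exists c, olt c a /\ ole b c).
  by right; apply: ole_olt_trans bc ca.
left; apply/oltP => c ca; apply: contrapT => ncb; apply: nh; exists c; split=> //.
apply/oltP => d db; have [cd|//] := IH c ca d.
by case: ncb; apply: ole_olt_trans cd db.
Qed.

Lemma olt_trans b a c : olt a b -> olt b c -> olt a c.
Proof. by move=> ab /oltW; apply: olt_ole_trans. Qed.

Lemma ord_cases a : [\/ is_ozero a, exists b, is_osucc b a | is_olimit a].
Proof.
have [h|/existsNP[b /contrapT ba]] := pselect (is_ozero a); first by constructor 1.
have [h|nh] := pselect (exists b, is_osucc b a); first by constructor 2.
constructor 3; split; first by exists b.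
move=> c ca; apply: contrapT => nc; apply: nh; exists c; split=> // d da.
by have [//|cd] := ole_total d c; case: nc; exists d.
Qed.

(** * Infinite time Turing machines *)

Definition real := nat -> bool.

Inductive tape := Input | Work | Output | Param.

Inductive state (n : nat) := Start | Limit | Halt | Aux of 'I_n.
Arguments Start {n}.
Arguments Limit {n}.
Arguments Halt {n}.

Inductive move := Left | Right.

(* One head scans the same position of all four tapes simultaneously.  The
   values of [delta] at [Halt] are never used, see [run_halt]. *)
Record program := Program {
  nstates : nat;
  delta : state nstates -> (tape -> bool) ->
          state nstates * (tape -> bool) * move
}.

Record config (p : program) := Config {
  cstate : state (nstates p);
  chead : nat;
  ctape : tape -> real
}.

Definition halted p (c : config p) : Prop := cstate c = Halt.

Definition init_config p (z x : real) : config p :=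
  Config Start 0 (fun t => match t with
    | Input => x
    | Param => z
    | Work | Output => fun=> false
    end).

(* A left move at the leftmost cell leaves the head there, as [0.-1 = 0]. *)
Definition step p (c : config p) : config p :=
  let: (q, w, m) := delta (cstate c) (fun t => ctape c t (chead c)) in
  Config q
    (match m with Left => (chead c).-1 | Right => (chead c).+1 end)
    (fun t i => if i == chead c then w t else ctape c t i).

(* For values in {0,1}, the limsup is 1 iff the value 1 occurs cofinally. *)
Definition limit_config p (C : Ord -> config p) (a : Ord) : config p :=
  Config Limit 0 (fun t i =>
    `[< forall b, olt b a ->
          exists c, [/\ ole b c, olt c a & ctape (C c) t i = true] >]).

(* The run of [p] with parameter [z] on input [x], continued through all
   ordinals by keeping the configuration unchanged once [Halt] is reached.  It
   exists and is unique: [exists_unique_run] below. *)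
Record is_run p (z x : real) (C : Ord -> config p) : Prop := IsRun {
  run_zero : forall a, is_ozero a -> C a = init_config p z x;
  run_succ : forall a b, is_osucc b a -> ~ halted (C b) -> C a = step (C b);
  run_limit : forall a, is_olimit a -> (forall b, olt b a -> ~ halted (C b)) ->
    C a = limit_config C a;
  run_halt : forall a b, olt b a -> halted (C b) -> C a = C b
}.

Lemma limit_config_ext p (C D : Ord -> config p) a :
  (forall b, olt b a -> C b = D b) -> limit_config C a = limit_config D a.
Proof.
move=> CD; congr Config; apply/funext => t; apply/funext => i.
apply: asbool_equiv_eq; split=> H b /H [c [bc ca e]]; exists c; split=> //.
  by rewrite -CD.
by rewrite CD.
Qed.

Lemma run_unique p z x (C D : Ord -> config p) :
  is_run z x C -> is_run z x D -> C = D.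
Proof.
move=> rC rD; apply/funext; elim/(well_founded_ind olt_wf) => a IH.
have [[b [ba hb]]|nh] := pselect (exists b, olt b a /\ halted (C b)).
  have hb' : halted (D b) by rewrite -IH.
  by rewrite (run_halt rC ba hb) (run_halt rD ba hb') IH.
have nhC b : olt b a -> ~ halted (C b) by move=> ba hb; apply: nh; exists b.
have nhD b : olt b a -> ~ halted (D b) by move=> ba; rewrite -IH //; apply: nhC.
case: (ord_cases a) => [a0|[b sb]|al].
- by rewrite (run_zero rC a0) (run_zero rD a0).
- have [ba _] := sb.
  by rewrite (run_succ rC sb (nhC _ ba)) (run_succ rD sb (nhD _ ba)) IH.
- by rewrite (run_limit rC al nhC) (run_limit rD al nhD); apply: limit_config_ext.
Qed.

Definition run_next p z x (a : Ord) (g : Ord -> config p) : config p :=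
  let H := [set b | olt b a /\ halted (g b)] in
  let S := [set b | is_osucc b a] in
  match pselect (exists b, H b) with
  | left h => g (projT1 (cid h))
  | right _ => match pselect (exists b, S b) with
    | left h => step (g (projT1 (cid h)))
    | right _ => if `[< is_ozero a >] then init_config p z x else limit_config g a
    end
  end.

Definition run_cut p z x (a : Ord) (r : forall b, olt b a -> config p) (b : Ord) :=
  match pselect (olt b a) with left h => r b h | right _ => init_config p z x end.

Definition run p z x : Ord -> config p :=
  Fix olt_wf (fun=> config p) (fun a r => run_next z x a (run_cut z x r)).

Lemma runE p z x a : @run p z x a =
  run_next z x a (fun b => if pselect (olt b a) then run p z x b else init_config p z x).
Proof.
rewrite /run Fix_eq => [|b f g fg].
  by congr run_next; apply/funext => b; rewrite /run_cut; case: pselect.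
by congr run_next; apply/funext => c; rewrite /run_cut; case: pselect.
Qed.

Lemma run_next_ext p z x a a' (g : Ord -> config p) :
  (forall b, olt b a <-> olt b a') -> run_next z x a g = run_next z x a' g.
Proof.
move=> e; rewrite /run_next.
have eq1 b : olt b a = olt b a' by apply/propext.
have -> : [set b | olt b a /\ halted (g b)] = [set b | olt b a' /\ halted (g b)].
  by apply/funext => b /=; rewrite eq1.
have -> : [set b | is_osucc b a] = [set b | is_osucc b a'].
  apply/funext => b /=; rewrite /is_osucc eq1; congr (_ /\ _).
  by apply: eq_forall => c; rewrite eq1.
have -> : is_ozero a = is_ozero a' by apply: eq_forall => c; rewrite eq1.
have -> // : limit_config g a = limit_config g a'.
congr Config; apply/funext => t; apply/funext => i; congr asbool.
apply: eq_forall => b; rewrite eq1; congr (_ -> _).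
by apply: eq_exists => c; rewrite eq1.
Qed.

Lemma run_ext p z x a a' :
  (forall b, olt b a <-> olt b a') -> run p z x a = run p z x a'.
Proof.
move=> e; rewrite !runE (run_next_ext _ _ _ e); congr run_next; apply/funext => b.
have eb := e b; case: (pselect (olt b a)) => h /=; case: (pselect (olt b a')) => h' //=.
  by case: h'; apply: eb.1.
by case: h; apply: eb.2.
Qed.

Lemma run_frozen p z x :
  forall a b, olt b a -> halted (run p z x b) ->
    run p z x a = run p z x b.
Proof.
elim/(well_founded_ind olt_wf) => a IH b ba hb.
rewrite runE /run_next; case: pselect => [h|[]]; last first.
  by exists b; split=> //; case: pselect.
case: cid => c /= [ca]; case: pselect => //= ? hc.
have [cb|bc] := ole_total c b; last exact: (IH c ca b bc hb).
have [bc|cb'] := ole_total b c; last by rewrite (IH b ba c cb' hc).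
by apply: run_ext => d; split=> H; [apply: olt_ole_trans H cb|apply: olt_ole_trans H bc].
Qed.

Lemma runP p z x : is_run z x (run p z x).
Proof.
split; last exact: run_frozen.
- move=> a a0; rewrite runE /run_next.
  case: pselect => [h|_]; first by have [b [ba _]] := h; case: (a0 _ ba).
  case: pselect => [h|_]; first by have [b [ba _]] := h; case: (a0 _ ba).
  by rewrite asboolT.
- move=> a b [ba sb] nb; rewrite runE /run_next.
  case: pselect => [h|_]; first case: cid => c /= [ca].
    case: pselect => //= ? hc; case: nb.
    have [bc|cb] := ole_total b c; last by rewrite /halted (run_frozen cb hc).
    rewrite /halted (@run_ext p z x b c) // => d.
    by split=> H; apply: olt_ole_trans H _ => //; apply: sb.
  case: pselect => [h|[]]; last by exists b.
  case: cid => c /= [ca sc]; case: pselect => //= ?; congr step.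
  by apply: run_ext => d; split=> H; apply: olt_ole_trans H _; [apply: sb|apply: sc].
- move=> a al nh; rewrite runE /run_next.
  case: pselect => [h|_]; first by have [c [ca]] := h; case: pselect => //= ? /(nh _ ca).
  case: pselect => [h|_]; first have [c [ca sc]] := h.
    by have [d [cd /sc dc]] := al.2 c ca; case: (@olt_irr c); apply: olt_ole_trans cd dc.
  rewrite asboolF; last by case: al => [[b ba] _] /(_ b).
  by apply: limit_config_ext => b ba; case: pselect.
Qed.

Theorem exists_unique_run p z x : exists! C : Ord -> config p, is_run z x C.
Proof. by exists (run p z x); split=> [|C]; [exact: runP|apply/run_unique/runP]. Qed.

Definition halts_with p (z x y : real) : Prop :=
  exists2 C : Ord -> config p, is_run z x C &
    exists a, halted (C a) /\ ctape (C a) Output = y.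

Definition eventually_shows p (z x y : real) : Prop :=
  exists2 C : Ord -> config p, is_run z x C &
    exists a, forall b, ole a b -> ctape (C b) Output = y.

Definition it_computable (f : real -> real) : Prop :=
  exists p z, forall x, halts_with p z x (f x).

Definition it_eventually_computable (f : real -> real) : Prop :=
  exists p z, forall x, eventually_shows p z x (f x).

(** * Enumerable equivalence relations and countable groups *)

Definition decode (x : real) (n : nat) : real :=
  fun k => x (Cantor.to_nat (n, k)).

Definition enumerates (f : real -> real) (E : real -> real -> Prop) : Prop :=
  forall x, range (decode (f x)) = [set y | E x y].

Definition it_enumerable (E : real -> real -> Prop) : Prop :=
  exists2 f, it_computable f & enumerates f E.

Definition it_eventually_enumerable (E : real -> real -> Prop) : Prop :=
  exists2 f, it_eventually_computable f & enumerates f E.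

Record is_bijection_group (G : set (real -> real)) : Prop := IsBijectionGroup {
  group_bij : forall g, G g -> bijective g;
  group_id : G id;
  group_comp : forall g h, G g -> G h -> G (g \o h);
  group_inv : forall g, G g -> exists h, [/\ G h, cancel g h & cancel h g]
}.

Definition orbit_rel (G : set (real -> real)) (x y : real) : Prop :=
  exists2 g, G g & g x = y.

(* Main.v *)
(* An orbit equivalence relation is enumerated by running countably many
   machines in parallel. Conversely, if [f] enumerates [E], then, as in the
   Feldman-Moore theorem, [E] is the orbit relation of the group generated by
   the involutions that exchange [x] and [y] when [y] is the [n]-th entry of
   [f x], [x] is the [n']-th entry of [f y], and [x], [y] differ at bit [i] in a
   prescribed way. Both directions only use that the (eventually) computable
   functions are closed under composition and countable pairing and contain the
   maps with open preimages of subbasic sets [{y | y k = 1}].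

   For these closure properties, consider transfinite processes on countably
   many bits that start from 0, take pointwise limsups at limits, and have a step
   in which every new bit is an open condition on the old bits and the input. A
   single machine simulates any such process: the step is coded in the parameter
   as an omega-sequence of guarded assignments, one process step taking two
   periods of length omega. Families of machines, with restarts, are easily seen
   to be such processes. *)

From HB Require Import structures.
From mathcomp Require Import zify.
Require Import Defs.

Set Implicit Arguments.
Unset Strict Implicit.
Unset Printing Implicit Defensive.

Local Open Scope classical_set_scope.

(** * Ordinals *)

(** A program is finite, while a process step consists of infinitely many unrelated conditions; this
    is why the step is read from the parameter. An open condition is a countable disjunction of
    finite tests, so a scratch bit that is reset once per period and then set by any successful test
    converges within omega steps. A condition that is merely closed, such as equality of reals or
    halting of all machines, is treated by computing its negation first. Two periods are needed
    because all bits change simultaneously: the old state has to stay readable until the new one is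
    complete. During the copying every cell holds its old or its new value; therefore limsups over
    machine stages agree with limsups over process stages, and a settled output does not flicker, as
    eventual computability requires. As all tapes share one head, the place in the instruction
    stream and the accessed cell have to be kept as marks on a tape, and these have to vanish at
    limits, where the stream starts afresh. *)

Lemma olt_ex_min (P : Ord -> Prop) :
  (exists a, P a) -> exists2 a, P a & forall b, olt b a -> ~ P b.
Proof.
move=> [a]; elim/(well_founded_ind olt_wf): a => a IH Pa.
have [[b [ba Pb]]|nh] := pselect (exists b, olt b a /\ P b); first exact: IH Pb.
by exists a => // b ba Pb; apply: nh; exists b.
Qed.

Lemma nolt a b : ~ olt a b <-> ole b a.
Proof.
split=> [nab|ba ab]; last by apply: (@olt_irr a); apply: olt_ole_trans ab ba.
by have [] := ole_total b a.
Qed.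

Definition oeq a b := ole a b /\ ole b a.

Lemma oeq_olt a b : oeq a b -> forall c, olt c a <-> olt c b.
Proof. by move=> [ab ba] c; split=> ca; apply: olt_ole_trans ca _. Qed.

Lemma olt_oeq a b : (forall c, olt c a <-> olt c b) -> oeq a b.
Proof. by move=> h; split; apply/oltP => c /h. Qed.

Lemma oeq_sym a b : oeq a b -> oeq b a.
Proof. by case. Qed.

Lemma is_osucc_oeq a b b' : is_osucc b a -> is_osucc b' a -> oeq b b'.
Proof. by move=> [ba sb] [ba' sb']; split; [exact: sb'|exact: sb]. Qed.

Lemma is_osucc_ole b a c : is_osucc b a -> olt b c -> ole a c.
Proof. by move=> [ba sb] bc; apply/(oltP a c) => d /sb /ole_olt_trans; apply. Qed.

Lemma oeq_is_olimit a b : oeq a b -> is_olimit a -> is_olimit b.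
Proof.
move=> /oeq_olt ab [[c ca] h]; split; first by exists c; apply/ab.
by move=> d /ab /h [e [de ea]]; exists e; split=> //; apply/ab.
Qed.

Lemma oeq_is_osucc a b c : oeq a b -> is_osucc c a -> is_osucc c b.
Proof. by move=> /oeq_olt ab [ca sc]; split=> [|d /ab]; [apply/ab|exact: sc]. Qed.

Lemma is_osucc_nlimit b a : is_osucc b a -> ~ is_olimit a.
Proof.
move=> [ba sb] [_ /(_ b ba) [c [bc /sb cb]]].
by apply: (@olt_irr b); apply: olt_ole_trans bc cb.
Qed.

Lemma nzero_gt a : ~ is_ozero a -> exists b, olt b a.
Proof. by move=> /existsNP[b /contrapT]; exists b. Qed.

Definition ozero : Ord := osup (fun v : void => match v with end).

Definition osucc (a : Ord) : Ord := osup (fun _ : unit => a).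

Lemma is_ozeroP : is_ozero ozero.
Proof. by move=> a [[]]. Qed.

Lemma is_ozero_le a b : is_ozero a -> ole a b.
Proof. by move=> a0; apply/oltP => c /a0. Qed.

Lemma olt_osucc b a : olt b (osucc a) <-> ole b a.
Proof. by split=> [[]|ba] //; exists tt. Qed.

Lemma osuccP a : is_osucc a (osucc a).
Proof. by split=> [|c /olt_osucc]//; apply/olt_osucc/ole_refl. Qed.

Lemma olt_succ a : olt a (osucc a).
Proof. by case: (osuccP a). Qed.

Lemma ole_osucc a b : ole a b -> ole (osucc a) (osucc b).
Proof. by move=> ab /= _; exists tt. Qed.

Lemma olimit_osucc a b : is_olimit a -> olt b a -> olt (osucc b) a.
Proof.
move=> [_ h] /h [c [bc ca]]; apply: ole_olt_trans ca.
exact: is_osucc_ole (osuccP b) bc.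
Qed.

(** The least upper bound; [osup] is the strict one. *)
Definition olub (A : Type) (k : A -> Ord) : Ord :=
  osup (fun p : {i : A & let: osup B _ := k i in B} =>
    match k (projT1 p) as o return (let: osup B _ := o in B) -> Ord with
    | osup B g => fun j => g j
    end (projT2 p)).

Lemma olt_olub A (k : A -> Ord) b : olt b (olub k) <-> exists i, olt b (k i).
Proof.
split=> [[[i j]] /=|[i]].
  by move=> bij; exists i; move: j bij; case: (k i) => B g j bj; exists j.
move=> bi.
suff [j bj] : exists j : (let: osup B _ := k i in B),
    ole b (match k i as o return (let: osup B _ := o in B) -> Ord with
           | osup B g => fun j => g j end j) by exists (existT _ i j).
by case: (k i) bi => B g [j bj]; exists j.
Qed.

(** Normal functions: [grow nx e] starts from [e] and iterates [nx], taking
    suprema at limits. *)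
Fixpoint grow (nx : Ord -> Ord) (e d : Ord) : Ord :=
  let: osup B h := d in
  olub (fun o : option B => if o is Some j then nx (grow nx e (h j)) else e).

Section Grow.
Variables (nx : Ord -> Ord) (e : Ord).
Hypothesis nx_mono : forall a b, ole a b -> ole (nx a) (nx b).
Hypothesis nx_gt : forall a, olt a (nx a).

Let G := grow nx e.

Lemma grow_mono a b : ole a b -> ole (G a) (G b).
Proof.
elim: a b => A f IH [B g] ab; apply/oltP => c /olt_olub [[i|]] ci; apply/olt_olub.
  have [j ij] := ab i; exists (Some j); apply: olt_ole_trans ci _.
  exact/nx_mono/IH.
by exists None.
Qed.

Lemma olt_grow t d :
  olt t (G d) <-> olt t e \/ exists2 d', olt d' d & olt t (nx (G d')).
Proof.
case: d => B h; split=> [/olt_olub[[j|]]|[te|[d' [j dj] td]]].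
- by move=> tj; right; exists (h j) => //; exists j; apply: ole_refl.
- by left.
- by apply/olt_olub; exists None.
- apply/olt_olub; exists (Some j); apply: olt_ole_trans td _.
  exact/nx_mono/grow_mono.
Qed.

Lemma grow_nx b a : olt b a -> ole (nx (G b)) (G a).
Proof. by move=> ba; apply/oltP => c cb; apply/olt_grow; right; exists b. Qed.

Lemma grow_lt b a : olt b a -> olt (G b) (G a).
Proof. by move/grow_nx; apply: olt_ole_trans. Qed.

Lemma grow_le_inv a b : ole (G a) (G b) -> ole a b.
Proof.
by move=> h; apply/nolt => /grow_lt /olt_ole_trans /(_ h); apply: olt_irr.
Qed.

Lemma grow_ge d : ole e (G d).
Proof. by apply/oltP => c ce; apply/olt_grow; left. Qed.

Lemma grow0 d : is_ozero d -> oeq (G d) e.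
Proof.
by move=> d0; apply: olt_oeq => c; split=> [/olt_grow[|[d' /d0]]|ce]//;
   apply/olt_grow; left.
Qed.

Lemma growS b a : is_osucc b a -> oeq (G a) (nx (G b)).
Proof.
move=> [ba sb]; split; last exact: grow_nx.
apply/oltP => c /olt_grow[ce|[d da cd]].
  by apply: olt_trans (nx_gt _); apply: olt_ole_trans ce (grow_ge _).
by apply: olt_ole_trans cd _; apply/nx_mono/grow_mono/sb.
Qed.

Lemma grow_cofinal a t : is_olimit a -> olt t (G a) ->
  exists2 b, olt b a & olt t (G b).
Proof.
move=> [[b ba] h] /olt_grow[te|[d da td]].
  by exists b => //; apply: olt_ole_trans te (grow_ge _).
have [c [dc ca]] := h d da; exists c => //.
exact: olt_ole_trans td (grow_nx dc).
Qed.

Lemma growL a : is_olimit a -> is_olimit (G a).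
Proof.
move=> al; split; first by have [[b /grow_lt]] := al; exists (G b).
move=> t /(grow_cofinal al) [b /grow_lt ba tb]; by exists (G b).
Qed.

Lemma ole_grow d : ole d (G d).
Proof.
elim/(well_founded_ind olt_wf): d => d IH; apply/oltP => c cd.
exact: ole_olt_trans (IH c cd) (grow_lt cd).
Qed.

(** Take the least [d] with [t] below [G d]; [olt_grow] then finds the period containing [t]. This
    matches machine stages with process stages. *)
Lemma grow_div t : ole e t -> exists2 d, ole (G d) t & olt t (nx (G d)).
Proof.
move=> et; have : exists d, olt t (G d).
  by exists (osucc t); apply: olt_ole_trans (olt_succ t) (ole_grow _).
move=> /olt_ex_min[d /olt_grow[te|[d' dd td]] dmin].
  by case: (@olt_irr t); apply: olt_ole_trans te et.
by exists d' => //; apply/nolt/dmin.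
Qed.

End Grow.

(** The ordinal sum [e + a]: where a machine restarted at stage [e] of a process reaches its own
    stage [a]. *)
Definition oadd := grow osucc.

Lemma oadd_lt e a b : olt a b -> olt (oadd e a) (oadd e b).
Proof. by apply: grow_lt; [exact: ole_osucc|exact: olt_succ]. Qed.

Lemma oadd_le e a b : ole a b -> ole (oadd e a) (oadd e b).
Proof. by apply: grow_mono; exact: ole_osucc. Qed.

Lemma oadd_ge e a : ole e (oadd e a).
Proof. by apply: grow_ge; [exact: ole_osucc]. Qed.

Lemma oadd_le_inv e a b : ole (oadd e a) (oadd e b) -> ole a b.
Proof. by apply: grow_le_inv; [exact: ole_osucc|exact: olt_succ]. Qed.

Lemma oadd0 e a : is_ozero a -> oeq (oadd e a) e.
Proof. by apply: grow0; exact: ole_osucc. Qed.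

Lemma oaddS e b a : is_osucc b a -> is_osucc (oadd e b) (oadd e a).
Proof.
move=> ba; apply: oeq_is_osucc (osuccP _).
by apply: oeq_sym; apply: growS ba; [exact: ole_osucc|exact: olt_succ].
Qed.

Lemma oaddL e a : is_olimit a -> is_olimit (oadd e a).
Proof. by apply: growL; [exact: ole_osucc|exact: olt_succ]. Qed.

Lemma oadd_sub e t : ole e t -> exists d, oeq t (oadd e d).
Proof.
move=> et; have [||d dt /olt_osucc td] := @grow_div osucc e _ _ t et.
- exact: ole_osucc.
- exact: olt_succ.
- by exists d.
Qed.

(** [a + omega] *)
Definition onext (a : Ord) : Ord := osup (fun n => iter n osucc a).

Lemma onext_iter a n : olt (iter n osucc a) (onext a).
Proof. by exists n; apply: ole_refl. Qed.

Lemma olt_onext a b : olt b (onext a) <-> exists n, ole b (iter n osucc a).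
Proof. by []. Qed.

Lemma onext_gt a : olt a (onext a).
Proof. exact: (onext_iter a 0). Qed.

Lemma ole_iter_osucc a b n : ole a b -> ole (iter n osucc a) (iter n osucc b).
Proof. by move=> ab; elim: n => //= n; exact: ole_osucc. Qed.

Lemma ole_onext a b : ole a b -> ole (onext a) (onext b).
Proof. by move=> ab n; exists n; apply: ole_iter_osucc. Qed.

Lemma onext_limit a : is_olimit (onext a).
Proof.
split; first by exists a; exact: onext_gt.
move=> b [n bn]; exists (iter n.+1 osucc a); split; last exact: onext_iter.
exact/olt_osucc.
Qed.

Lemma ole_iter a n : ole a (iter n osucc a).
Proof. by elim: n => [|n IH]; [exact: ole_refl|apply: oltW; exact/olt_osucc]. Qed.

Lemma iter_osucc_mono a m n : m <= n -> ole (iter m osucc a) (iter n osucc a).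
Proof. by move=> /subnKC <-; rewrite addnC iterD; exact: ole_iter. Qed.

Lemma onext_between a b : ole a b -> olt b (onext a) ->
  exists n, oeq b (iter n osucc a).
Proof.
move=> ab [n]; elim: n => [|n IH] bn; first by exists 0.
have [/IH//|nb] := ole_total b (iter n osucc a).
by exists n.+1; split=> //; apply: is_osucc_ole (osuccP _) nb.
Qed.

(** * Open transfinite processes *)

Definition olimsup (v : Ord -> bool) (a : Ord) : Prop :=
  forall b, olt b a -> exists c, [/\ ole b c, olt c a & v c].

Lemma olimsup_const (v : Ord -> bool) (w : bool) a b : olt b a ->
  (forall c, ole b c -> olt c a -> v c = w) -> (olimsup v a <-> w).
Proof.
move=> ba vw; split=> [/(_ b ba) [c [bc ca vc]]|tw d da]; first by rewrite -(vw c).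
have [db|/oltW bd] := ole_total d b; [exists b|exists d]; split=> //.
- by rewrite vw //; exact: ole_refl.
- exact: ole_refl.
- by rewrite vw.
Qed.

Section Open.
Variable X : eqType.

(** Open sets of, and continuous maps to a discrete space from, the product
    space [X -> bool]. *)
Definition opn (P : (X -> bool) -> Prop) : Prop :=
  forall u, P u -> exists K : seq X, forall v, {in K, u =1 v} -> P v.

Definition cont (T : Type) (g : (X -> bool) -> T) : Prop :=
  forall u, exists K : seq X, forall v, {in K, u =1 v} -> g u = g v.

Lemma cont_opn (g : (X -> bool) -> bool) : cont g -> opn g.
Proof. by move=> cg u gu; have [K Kv] := cg u; exists K => v /Kv <-. Qed.

Lemma cont_cst T (t : T) : cont (fun=> t).
Proof. by move=> u; exists [::]. Qed.

Lemma cont_bit x : cont (fun u => u x).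
Proof. by move=> u; exists [:: x] => v; apply; rewrite inE. Qed.

Lemma cont_comp T T' (h : T -> T') g : cont g -> cont (fun u => h (g u)).
Proof. by move=> cg u; have [K Kv] := cg u; exists K => v /Kv ->. Qed.

Lemma cont_comp2 T1 T2 T (h : T1 -> T2 -> T) g1 g2 :
  cont g1 -> cont g2 -> cont (fun u => h (g1 u) (g2 u)).
Proof.
move=> c1 c2 u; have [K1 H1] := c1 u; have [K2 H2] := c2 u.
exists (K1 ++ K2) => v uv; rewrite (H1 v) ?(H2 v) // => x xK; apply: uv;
  by rewrite mem_cat xK ?orbT.
Qed.

Lemma opn_cst (P : Prop) : opn (fun=> P).
Proof. by move=> u Pu; exists [::]. Qed.

Lemma opn_ex T (P : T -> (X -> bool) -> Prop) :
  (forall t, opn (P t)) -> opn (fun u => exists t, P t u).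
Proof. by move=> oP u [t /oP[K Kv]]; exists K => v /Kv; exists t. Qed.

Lemma opn_and P Q : opn P -> opn Q -> opn (fun u => P u /\ Q u).
Proof.
move=> oP oQ u [/oP[K1 H1] /oQ[K2 H2]]; exists (K1 ++ K2) => v uv.
by split; [apply: H1|apply: H2] => x xK; apply: uv; rewrite mem_cat xK ?orbT.
Qed.

Lemma opn_if (g : (X -> bool) -> bool) P Q : cont g -> opn P -> opn Q ->
  opn (fun u => if g u then P u else Q u).
Proof.
move=> cg oP oQ u; have [K1 H1] := cg u.
case E : (g u); [move=> /oP|move=> /oQ]; move=> [K2 H2]; exists (K1 ++ K2) => v uv;
  (rewrite -(H1 v) ?E; last by move=> x xK; apply: uv; rewrite mem_cat xK);
  by apply: H2 => x xK; apply: uv; rewrite mem_cat xK orbT.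
Qed.

End Open.

Section Process.
Variable I : Type.
Variable F : (nat + I -> bool) -> I -> Prop.

Definition join (x : real) (s : I -> bool) : nat + I -> bool :=
  fun k => match k with inl j => x j | inr i => s i end.

Definition proc_next x a (g : Ord -> I -> bool) : I -> bool := fun i =>
  `[< (exists2 b, is_osucc b a & F (join x (g b)) i) \/
      (is_olimit a /\ olimsup (g^~ i) a) >].

Definition proc_cut a (r : forall b, olt b a -> I -> bool) b : I -> bool :=
  match pselect (olt b a) with left h => r b h | right _ => fun=> false end.

(** The transfinite process started at [0], with step [F] (which also sees the
    input [x]) and pointwise limsup at limits. *)
Definition proc x : Ord -> I -> bool :=
  Fix olt_wf (fun=> I -> bool) (fun a r => proc_next x a (proc_cut r)).

Lemma proc_next_ext x a g g' : (forall b, olt b a -> g b = g' b) ->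
  proc_next x a g = proc_next x a g'.
Proof.
move=> gg; apply/funext => i; apply: asbool_equiv_eq.
split=> -[[b sb Fb]|[al h]]; [left|right|left|right].
- by exists b => //; rewrite -gg //; case: sb.
- by split=> // b /h [c [bc ca gc]]; exists c; rewrite -gg.
- by exists b => //; rewrite gg //; case: sb.
- by split=> // b /h [c [bc ca gc]]; exists c; rewrite gg.
Qed.

Lemma procE x a : proc x a = proc_next x a (proc x).
Proof.
rewrite {1}/proc Fix_eq => [|b f g fg]; last first.
  congr proc_next; apply/funext => c; rewrite /proc_cut; case: pselect => //.
by apply: proc_next_ext => b ba; rewrite /proc_cut; case: pselect.
Qed.

Lemma proc_oeq x a b : oeq a b -> proc x a = proc x b.
Proof.
move=> ab; rewrite !procE; apply/funext => i; apply: asbool_equiv_eq.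
have ba := oeq_sym ab; split=> -[[c sc Fc]|[al h]]; [left|right|left|right].
- by exists c => //; apply: oeq_is_osucc sc.
- split; first exact: oeq_is_olimit al.
  by move=> c /(oeq_olt ab)/h [d [cd da vd]]; exists d; split=> //; apply/(oeq_olt ab).
- by exists c => //; apply: oeq_is_osucc sc.
- split; first exact: oeq_is_olimit al.
  by move=> c /(oeq_olt ba)/h [d [cd da vd]]; exists d; split=> //; apply/(oeq_olt ba).
Qed.

Lemma proc0 x a i : is_ozero a -> proc x a i = false.
Proof.
move=> a0; rewrite procE; apply: asboolF => -[[b [/a0]//]|[[[b /a0]//]]].
Qed.

Lemma procS x a b i : is_osucc b a -> proc x a i = `[< F (join x (proc x b)) i >].
Proof.
move=> sb; rewrite procE; apply: asbool_equiv_eq; split=> [[[c sc]|[al]]|Fb].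
- by rewrite (proc_oeq x (is_osucc_oeq sb sc)).
- by case: (is_osucc_nlimit sb al).
- by left; exists b.
Qed.

Lemma procL x a i : is_olimit a -> proc x a i = `[< olimsup ((proc x)^~ i) a >].
Proof.
move=> al; rewrite procE; apply: asbool_equiv_eq.
by split=> [[[b /is_osucc_nlimit/(_ al)//]|[]]|h]//; right.
Qed.

(** A limsup creates no new 1, so every 1 goes back to an application of [F]. This serves for
    halting bits, which certify an earlier event. *)
Lemma proc_origin x a i : proc x a i ->
  exists2 b, olt b a & F (join x (proc x b)) i.
Proof.
elim/(well_founded_ind olt_wf): a => a IH.
case: (ord_cases a) => [a0|[b sb]|al]; first by rewrite proc0.
  by rewrite (procS _ _ sb) => /asboolP Fb; exists b => //; case: sb.
rewrite procL // => /asboolP h; have [[b ba] _] := al.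
have [c [_ ca /(IH c ca) [d dc Fd]]] := h b ba.
by exists d => //; apply: olt_trans dc ca.
Qed.

Lemma proc_const x a c i (v : bool) : olt c a ->
  (forall b, ole c b -> olt b a -> (F (join x (proc x b)) i <-> v)) ->
  proc x a i = v.
Proof.
elim/(well_founded_ind olt_wf): a => a IH ca Fv.
case: (ord_cases a) => [a0|[b sb]|al]; first by case: (a0 _ ca).
  rewrite (procS _ _ sb).
  have [ba sb'] := sb.
  by rewrite (asbool_equiv_eq (Fv b (sb' _ ca) ba)) asboolb.
rewrite procL //.
(* Nothing is known about the bit at stage [c] itself; it is determined only from [osucc c] on. *)
have sca := olimit_osucc al ca.
rewrite (asbool_equiv_eq (olimsup_const (w := v) sca _)) ?asboolb //.
move=> d cd da; apply: IH => //; first exact: olt_ole_trans (olt_succ _) cd.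
by move=> b cb bd; apply: Fv => //; apply: olt_trans bd da.
Qed.

End Process.

(** * A machine driven by an instruction stream *)

Definition tape_code (t : tape) : 'I_4 :=
  match t with Input => inord 0 | Work => inord 1 | Output => inord 2 | Param => inord 3 end.

Definition tape_decode (i : 'I_4) : tape :=
  match val i with 0 => Input | 1 => Work | 2 => Output | _ => Param end.

Lemma tape_codeK : cancel tape_code tape_decode.
Proof. by case; rewrite /tape_decode /= inordK. Qed.

HB.instance Definition _ := Finite.copy tape (can_type tape_codeK).

(** The machine has a register [r] and two pointers to blocks of two columns,
    an instruction pointer and a data pointer. [OTest t o v] lets [r] drop to 0
    unless the cell of tape [t] and column parity [o] in the data block is [v];
    [OSet t o v0 v1], if [r = 1], replaces a 0 there by [v0] and a 1 by [v1];
    [ORgt] and [OLft] move the data pointer, [OOne] sets [r], and [OHalt] halts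
    if [r = 1]. *)
Inductive op :=
  | OTest (t : tape) (o v : bool)
  | OSet (t : tape) (o v0 v1 : bool)
  | ORgt | OLft | OOne | OHalt.

Definition op_code (o : op) : (tape * bool * bool) + (tape * bool * bool * bool) + 'I_4 :=
  match o with
  | OTest t o v => inl (inl (t, o, v))
  | OSet t o v0 v1 => inl (inr (t, o, v0, v1))
  | ORgt => inr (inord 0) | OLft => inr (inord 1)
  | OOne => inr (inord 2) | OHalt => inr (inord 3)
  end.

Definition op_decode (c : (tape * bool * bool) + (tape * bool * bool * bool) + 'I_4) : op :=
  match c with
  | inl (inl (t, o, v)) => OTest t o v
  | inl (inr (t, o, v0, v1)) => OSet t o v0 v1
  | inr i => match val i with 0 => ORgt | 1 => OLft | 2 => OOne | _ => OHalt end
  end.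

Lemma op_codeK : cancel op_code op_decode.
Proof. by case => //=; rewrite inordK. Qed.

HB.instance Definition _ := Finite.copy op (can_type op_codeK).

(** The instruction pointer stays to the right of the data pointer, so that
    among the two marks the left one is always the latter. An instruction is
    fetched at the right mark, which is moved to the next block ([KA1] to
    [KA3]); then the head seeks the left mark, acts there and goes back. The
    letters [E] and [O] tell the parity of the column. *)
Inductive kind := KI1 | KI2 | KI3 | KFetch | KA1 | KA2 | KA3 | KSeekE | KSeekO
  | KAct | KSkip | KR1 | KR2 | KL1 | KL2 | KBackE | KBackO.

Definition kinds := [:: KI1; KI2; KI3; KFetch; KA1; KA2; KA3; KSeekE; KSeekO;
  KAct; KSkip; KR1; KR2; KL1; KL2; KBackE; KBackO].

Definition kind_code (k : kind) : 'I_17 := inord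
  match k with
  | KI1 => 0 | KI2 => 1 | KI3 => 2 | KFetch => 3 | KA1 => 4 | KA2 => 5 | KA3 => 6
  | KSeekE => 7 | KSeekO => 8 | KAct => 9 | KSkip => 10 | KR1 => 11 | KR2 => 12
  | KL1 => 13 | KL2 => 14 | KBackE => 15 | KBackO => 16
  end.

Lemma kind_codeK : cancel kind_code (fun i => nth KI1 kinds i).
Proof. by case; rewrite /= inordK. Qed.

HB.instance Definition _ := Finite.copy kind (can_type kind_codeK).

Lemma card_op_gt0 : 0 < #|{: op}|.
Proof. by apply/card_gt0P; exists OOne. Qed.

(** The finite control counts blocks modulo the number of operations, so that one bit per block
    suffices to select an operation. *)
Definition cidx (s : nat) : 'I_#|{: op}| := Ordinal (ltn_pmod s card_op_gt0).

Lemma cidxS s : ordS (cidx s) = cidx s.+1.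
Proof. by apply: val_inj; rewrite /= -!(addn1 s) -addn1 modnDml. Qed.

(** The phase, the operation counter, the register, and the fetched instruction bit. *)
Definition ctl : finType := (kind * 'I_#|{: op}| * bool * bool)%type.

Definition setw (w : tape -> bool) t v : tape -> bool :=
  fun t' => if t' == t then v else w t'.

(** The instruction mark is advanced before the operation is performed, so a right move of the data
    mark cannot run into it. The last branch of [KAct] is unreachable, as this phase is entered only
    for tests and assignments. *)
Definition ctl_step (q : ctl) (w : tape -> bool) :
    state #|ctl| * (tape -> bool) * move :=
  let: (k, c, r, b) := q in
  let go k c r b : state #|ctl| := Aux (enum_rank ((k, c, r, b) : ctl)) in
  match k with
  | KI1 => (go KI2 c r b, setw w Param false, Right)
  | KI2 => (go KI3 c r b, w, Right)
  | KI3 => (go KFetch c r b, setw w Param false, Left)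
  | KFetch => (go KA1 c r (w Param), w, Right)
  | KA1 => (go KA2 c r b, setw w Param true, Right)
  | KA2 => (go KA3 c r b, w, Right)
  | KA3 => (if b then go KSeekE c r b else go KFetch (ordS c) r false,
            setw w Param false, Left)
  | KSeekE => (go KSeekO c r b, w, Left)
  | KSeekO =>
      if w Param then (go KSeekE c r b, w, Left) else
      match enum_val c with
      | OTest t true v => (go KBackE c (r && (w t == v)) b, w, Right)
      | OSet t true v0 v1 =>
          (go KBackE c r b,
           if r then setw w t (if w t then v1 else v0) else w, Right)
      | OTest _ false _ | OSet _ false _ _ => (go KAct c r b, w, Left)
      | ORgt => (go KR1 c r b, setw w Param true, Right)
      | OLft => (go KL1 c r b, setw w Param true, Left)
      | OOne => (go KBackE c true b, w, Right)
      | OHalt => (if r then Halt else go KBackE c r b, w, Right)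
      end
  | KAct =>
      match enum_val c with
      | OTest t _ v => (go KSkip c (r && (w t == v)) b, w, Right)
      | OSet t _ v0 v1 =>
          (go KSkip c r b,
           if r then setw w t (if w t then v1 else v0) else w, Right)
      | _ => (Halt, w, Right)
      end
  | KSkip => (go KBackE c r b, w, Right)
  | KR1 => (go KR2 c r b, w, Right)
  | KR2 => (go KBackE c r b, setw w Param false, Right)
  | KL1 => (go KL2 c r b, w, Left)
  | KL2 => (go KBackE c r b, setw w Param false, Right)
  | KBackE => (go KBackO c r b, w, Right)
  | KBackO => if w Param then (go KBackE c r b, w, Right)
              else (go KFetch (ordS c) r false, w, Left)
  end.

(** [Start] and [Limit] behave alike, so every period of length omega replays the instruction
    stream. The first move leads to column 1, which carries the mark of block 0. *)
Definition univ : program := Program (nstates := #|ctl|) (fun s w =>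
  match s with
  | Start | Limit => (Aux (enum_rank ((KI1, cidx 0, false, false) : ctl)), w, Right)
  | Halt => (Halt, w, Left)
  | Aux i => ctl_step (enum_val i) w
  end).

(** * Symbolic execution of the universal machine *)

Definition upd (D : tape -> real) t h v : tape -> real :=
  fun t' i => if (t' == t) && (i == h) then v else D t' i.

Section Univ.
Variable u : nat -> bool.

(** Column [2p] of [Param] holds the instruction bit [u p]; column [2p+1] holds
    [0] exactly when block [p] is marked.  As the marks are zeros, they are
    erased by limsups. *)
Definition tp (D : tape -> real) (M : nat -> bool) : tape -> real := fun t i =>
  if t == Param then (if odd i then ~~ M i./2 else u i./2) else D t i.

Definition mk1 (j : nat) := fun p : nat => p == j.
Definition mk2 (j t : nat) := fun p : nat => (p == j) || (p == t).

Lemma tp_even D M p : tp D M Param p.*2 = u p.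
Proof. by rewrite /tp eqxx odd_double doubleK. Qed.

Lemma tp_odd D M p : tp D M Param p.*2.+1 = ~~ M p.
Proof. by rewrite /tp eqxx /= odd_double uphalf_double. Qed.

Lemma tp_data D M t i : t != Param -> tp D M t i = D t i.
Proof. by rewrite /tp => /negbTE ->. Qed.

Lemma tp_id D M h :
  (fun t i => if i == h then tp D M t h else tp D M t i) = tp D M.
Proof. by apply/funext => t; apply/funext => i; case: eqP => // ->. Qed.

Lemma tp_mark D M M' p v : M' = (fun i => if i == p then ~~ v else M i) ->
  (fun t i => if i == p.*2.+1 then setw (fun t => tp D M t p.*2.+1) Param v t
              else tp D M t i) = tp D M'.
Proof.
move=> ->; apply/funext => t; apply/funext => i; rewrite /setw /tp.
case: eqP => [->|ni]; case: eqP => // _.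
  by rewrite /= odd_double uphalf_double eqxx /= negbK.
case: ifP => // oi; case: eqP => // ip.
by case: ni; rewrite -(odd_double_half i) oi ip.
Qed.

Lemma tp_upd D M h t v : t != Param ->
  (fun t' i => if i == h then setw (fun t => tp D M t h) t v t'
              else tp D M t' i) = tp (upd D t h v) M.
Proof.
move=> tP; apply/funext => t'; apply/funext => i; rewrite /setw /tp /upd.
have [->|] := eqVneq i h; have [->|] := eqVneq t' t; rewrite ?(negbTE tP) //=.
Qed.

Definition cf k s r b h D M : config univ :=
  @Config univ (Aux (enum_rank ((k, cidx s, r, b) : ctl))) h (tp D M).

Lemma step_cf k s r b h D M : step (cf k s r b h D M) =
  let: (q, w, m) := ctl_step (k, cidx s, r, b) (fun t => tp D M t h) in
  @Config univ q (match m with Left => h.-1 | Right => h.+1 end)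
    (fun t i => if i == h then w t else tp D M t i).
Proof. by rewrite /step /= enum_rankK. Qed.

Definition dat (P : (tape -> real) -> Prop) (c : config univ) : Prop :=
  ~ halted c /\ exists D M, P D /\ ctape c = tp D M.

(** Intermediate configurations are controlled because the next limsup ranges over all of them. The
    end is exempt, so that it may be halted; positive length ensures that infinitely many operations
    fill a whole period. *)
Definition reach (R : config univ -> Prop) (c c' : config univ) : Prop :=
  exists n, [/\ 0 < n, iter n (@step univ) c = c' &
    forall k, k < n -> R (iter k (@step univ) c)].

Lemma reach1 (R : config univ -> Prop) c c' : R c -> step c = c' -> reach R c c'.
Proof. by move=> Rc <-; exists 1; split=> // -[]. Qed.

Lemma reach_trans R c c' c'' : reach R c c' -> reach R c' c'' -> reach R c c''.
Proof.
move=> [n [n0 <- Rn]] [m [m0 <- Rm]]; exists (m + n); split.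
- by rewrite addn_gt0 m0.
- by rewrite iterD.
- move=> k kmn; have [/Rn//|nk] := ltnP k n.
  by rewrite -(subnK nk) iterD; apply: Rm; rewrite ltn_subLR // addnC.
Qed.

Lemma dat_cf (P : (tape -> real) -> Prop) k s r b h D M :
  P D -> dat P (cf k s r b h D M).
Proof. by move=> PD; split=> //; exists D, M. Qed.

Definition mst := (nat * bool * (tape -> real))%type.

Definition mexec (o : op) (m : mst) : mst :=
  let: (j, r, D) := m in
  match o with
  | OTest t o v => (j, r && (D t (o + j.*2) == v), D)
  | OSet t o v0 v1 => (j, r, if r then
      upd D t (o + j.*2) (if D t (o + j.*2) then v1 else v0) else D)
  | ORgt => (j.+1, r, D)
  | OLft => (j.-1, r, D)
  | OOne => (j, true, D)
  | OHalt => (j, r, D)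
  end.

(** On [Param] the actual cells carry instructions and marks instead of [D]. An [OHalt] that takes
    effect is treated separately, in [run_halt_op]. *)
Definition op_ok (o : op) (m : mst) : Prop :=
  match o with
  | OTest t _ _ | OSet t _ _ _ => t != Param
  | OLft => 0 < m.1.1
  | OHalt => ~~ m.1.2
  | _ => True
  end.

(** The instruction bit of index [s] sits in block [s.+1], since the data mark starts in block 0 and
    the instruction mark right of it. *)
Definition cfg s (m : mst) : config univ :=
  cf KFetch s m.1.2 false s.+1.*2 m.2 (mk2 m.1.1 s.+1).

Ltac one_step lem := apply: reach1; [exact: dat_cf|
  rewrite step_cf /= ?tp_odd ?tp_even ?lem /=; rewrite /cf ?cidxS].

Lemma seek (P : (tape -> real) -> Prop) s r b D j t p : P D -> j <= p -> p < t ->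
  reach (dat P) (cf KSeekE s r b p.+1.*2 D (mk2 j t)) (cf KSeekO s r b j.*2.+1 D (mk2 j t)).
Proof.
move=> PD /subnKC <-; elim: (p - j) => [|d IH] pt.
  by rewrite addn0; one_step tp_id.
rewrite addnS in pt *; apply: (@reach_trans _ _ (cf KSeekO s r b (j + d).+1.*2.+1 D (mk2 j t))).
  by one_step tp_id.
apply: (@reach_trans _ _ (cf KSeekE s r b (j + d).+1.*2 D (mk2 j t))).
  one_step tp_id; rewrite /mk2 -addnS -{2}(addn0 j) eqn_add2l /=.
  by rewrite addnS ltn_eqF //= tp_id.
by apply: IH; exact: ltnW.
Qed.

Lemma back (P : (tape -> real) -> Prop) s r b D j t p : P D -> j < p -> p <= t ->
  reach (dat P) (cf KBackE s r b p.*2 D (mk2 j t)) (cf KFetch s.+1 r false t.*2 D (mk2 j t)).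
Proof.
move=> PD jp /subnKC; move: (t - p) => d <-; elim: d p jp => [|d IH] p jp.
  rewrite addn0; apply: (@reach_trans _ _ (cf KBackO s r b p.*2.+1 D (mk2 j p))).
    by one_step tp_id.
  by one_step tp_id; rewrite /mk2 eqxx orbT /= tp_id.
apply: (@reach_trans _ _ (cf KBackO s r b p.*2.+1 D (mk2 j (p + d.+1)))).
  by one_step tp_id.
apply: (@reach_trans _ _ (cf KBackE s r b p.+1.*2 D (mk2 j (p + d.+1)))).
  one_step tp_id; rewrite /mk2 gtn_eqF //= -{1}(addn0 p) eqn_add2l /= tp_id //.
by rewrite -addSnnS; apply: IH; exact: ltnW.
Qed.

Lemma advance (P : (tape -> real) -> Prop) s j r D : P D -> j <= s ->
  reach (dat P) (cfg s (j, r, D))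
    (if u s.+1 then cf KSeekE s r true s.+2.*2 D (mk2 j s.+2)
     else cf KFetch s.+1 r false s.+2.*2 D (mk2 j s.+2)).
Proof.
move=> PD js.
apply: (@reach_trans _ _ (cf KA1 s r (u s.+1) s.+1.*2.+1 D (mk2 j s.+1))).
  by one_step tp_id.
apply: (@reach_trans _ _ (cf KA2 s r (u s.+1) s.+2.*2 D (mk1 j))).
  apply: reach1; first exact: dat_cf.
  rewrite step_cf /= (@tp_mark _ _ (mk1 j)) //.
  apply/funext => p; rewrite /mk1 /mk2; case: (eqVneq p s.+1) => [->|_].
    by rewrite gtn_eqF.
  by rewrite orbF.
apply: (@reach_trans _ _ (cf KA3 s r (u s.+1) s.+2.*2.+1 D (mk1 j))).
  by one_step tp_id.
apply: reach1; first exact: dat_cf.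
rewrite step_cf /= (@tp_mark _ _ (mk2 j s.+2)); last first.
  apply/funext => p; rewrite /mk1 /mk2; case: (eqVneq p s.+2) => [->|_].
    by rewrite orbT.
  by rewrite orbF.
by case: (u s.+1); rewrite /cf ?cidxS.
Qed.

Lemma run_skip (P : (tape -> real) -> Prop) s j r D : P D -> j <= s ->
  u s.+1 = false -> reach (dat P) (cfg s (j, r, D)) (cfg s.+1 (j, r, D)).
Proof. by move=> PD js us; have := advance r PD js; rewrite us. Qed.

Lemma run_op (P : (tape -> real) -> Prop) s j r D o :
  j <= s -> u s.+1 -> enum_val (cidx s) = o -> op_ok o (j, r, D) ->
  P D -> P (mexec o (j, r, D)).2 ->
  reach (dat P) (cfg s (j, r, D)) (cfg s.+1 (mexec o (j, r, D))).
Proof.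
move=> js us eo oko PD PD'.
have := advance r PD js; rewrite us => /reach_trans; apply.
have js1 : j <= s.+1 by apply: leq_trans js _.
apply: reach_trans (seek _ _ _ PD js1 _) _ => //.
have J : tp D (mk2 j s.+2) Param j.*2.+1 = false by rewrite tp_odd /mk2 eqxx.
have B D' r' : P D' -> reach (dat P)
    (cf KBackE s r' true j.+1.*2 D' (mk2 j s.+2)) (cfg s.+1 (j, r', D')).
  by move=> PD2; apply: back => //; rewrite ltnS.
case: o eo oko PD' => [t [] v|t [] v0 v1||||] /= eo oko PD'.
- apply: reach_trans (B _ _ PD); apply: reach1; first exact: dat_cf.
  by rewrite step_cf /= J eo /= tp_id tp_data.
- apply: (@reach_trans _ _ (cf KAct s r true j.*2 D (mk2 j s.+2))).
    apply: reach1; first exact: dat_cf.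
    by rewrite step_cf /= J eo /= tp_id.
  apply: (@reach_trans _ _ (cf KSkip s (r && (D t j.*2 == v)) true j.*2.+1 D (mk2 j s.+2))).
    apply: reach1; first exact: dat_cf.
    by rewrite step_cf /= eo /= tp_id tp_data.
  apply: reach_trans (B _ _ PD); apply: reach1; first exact: dat_cf.
  by rewrite step_cf /= tp_id.
- apply: reach_trans (B _ _ PD'); apply: reach1; first exact: dat_cf.
  rewrite step_cf /= J eo /= /cf; congr Config.
  by case: (r); rewrite ?tp_id // tp_data // tp_upd.
- apply: (@reach_trans _ _ (cf KAct s r true j.*2 D (mk2 j s.+2))).
    apply: reach1; first exact: dat_cf.
    by rewrite step_cf /= J eo /= tp_id.
  apply: (@reach_trans _ _ (cf KSkip s r true j.*2.+1 
     (if r then upd D t j.*2 (if D t j.*2 then v1 else v0) else D) (mk2 j s.+2))).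
    apply: reach1; first exact: dat_cf.
    rewrite step_cf /= eo /= /cf; congr Config.
    by case: (r); rewrite ?tp_id // tp_data // tp_upd.
  apply: reach_trans (B _ _ PD'); apply: reach1; first exact: dat_cf.
  by rewrite step_cf /= tp_id.
- apply: (@reach_trans _ _ (cf KR1 s r true j.+1.*2 D (mk1 s.+2))).
    apply: reach1; first exact: dat_cf.
    rewrite step_cf /= J eo /= (@tp_mark _ _ (mk1 s.+2)) //.
    apply/funext => p; rewrite /mk1 /mk2; case: (eqVneq p j) => [->|//].
    by rewrite ltn_eqF.
  apply: (@reach_trans _ _ (cf KR2 s r true j.+1.*2.+1 D (mk1 s.+2))).
    by one_step tp_id.
  apply: (@reach_trans _ _ (cf KBackE s r true j.+2.*2 D (mk2 j.+1 s.+2))).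
    apply: reach1; first exact: dat_cf.
    rewrite step_cf /= (@tp_mark D (mk1 s.+2) (mk2 j.+1 s.+2) j.+1) //.
  by apply: back.
- case: j js js1 J B oko PD' => // j js js1 J _ _ _.
  apply: (@reach_trans _ _ (cf KL1 s r true j.+1.*2 D (mk1 s.+2))).
    apply: reach1; first exact: dat_cf.
    rewrite step_cf /= J eo /= (@tp_mark _ _ (mk1 s.+2)) //.
    apply/funext => p; rewrite /mk1 /mk2; case: (eqVneq p j.+1) => [->|//].
    by rewrite ltn_eqF // ltnW.
  apply: (@reach_trans _ _ (cf KL2 s r true j.*2.+1 D (mk1 s.+2))).
    by one_step tp_id.
  apply: (@reach_trans _ _ (cf KBackE s r true j.+1.*2 D (mk2 j s.+2))).
    apply: reach1; first exact: dat_cf.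
    rewrite step_cf /= (@tp_mark D (mk1 s.+2) (mk2 j s.+2) j) //.
  by apply: back => //; apply: ltnW.
- apply: reach_trans (B _ _ PD); apply: reach1; first exact: dat_cf.
  by rewrite step_cf /= J eo /= tp_id.
- apply: reach_trans (B _ _ PD); apply: reach1; first exact: dat_cf.
  by rewrite step_cf /= J eo /= (negbTE oko) tp_id.
Qed.

Lemma run_halt_op (P : (tape -> real) -> Prop) s j D :
  j <= s -> u s.+1 -> enum_val (cidx s) = OHalt -> P D ->
  exists c, [/\ reach (dat P) (cfg s (j, true, D)) c, halted c &
    exists M, ctape c = tp D M].
Proof.
move=> js us eo PD.
exists (@Config univ Halt j.*2.+2 (tp D (mk2 j s.+2))); split=> //; last by eexists.
have := advance true PD js; rewrite us => /reach_trans; apply.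
apply: reach_trans (seek _ _ _ PD (leqW js) _) _ => //.
apply: reach1; first exact: dat_cf.
by rewrite step_cf /= tp_odd /mk2 eqxx /= eo /= tp_id.
Qed.

Lemma run_start c D (P : (tape -> real) -> Prop) : P D ->
  cstate c = Start \/ cstate c = Limit -> chead c = 0 ->
  ctape c = tp D (fun=> false) -> reach (dat P) c (cfg 0 (0, false, D)).
Proof.
move=> PD cs ch ct.
have c0 : dat P c.
  by split; [rewrite /halted; case: cs => ->|exists D, (fun=> false)].
apply: (@reach_trans _ _ (cf KI1 0 false false 0.*2.+1 D (fun=> false))).
  by apply: reach1 => //; rewrite /step ct ch /=; case: cs => -> /=; rewrite tp_id.
apply: (@reach_trans _ _ (cf KI2 0 false false 1.*2 D (mk1 0))).
  apply: reach1; first exact: dat_cf.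
  rewrite step_cf /= (@tp_mark D (fun=> false) (mk1 0) 0) //.
  by apply/funext => p; rewrite /mk1; case: (eqVneq p 0).
apply: (@reach_trans _ _ (cf KI3 0 false false 1.*2.+1 D (mk1 0))).
  by one_step tp_id.
apply: reach1; first exact: dat_cf.
rewrite step_cf /= (@tp_mark D (mk1 0) (mk2 0 1) 1) //.
by apply/funext => p; rewrite /mk1 /mk2; case: (eqVneq p 1) => [->|]; rewrite ?orbF.
Qed.

End Univ.

(** * Runs over a period of length omega *)

Lemma is_run_oeq p z x (C : Ord -> config p) a b :
  is_run z x C -> oeq a b -> C a = C b.
Proof.
by move=> rC /oeq_olt ab; rewrite (run_unique rC (runP p z x)); apply: run_ext.
Qed.

Lemma run_iter p z x (C : Ord -> config p) a n : is_run z x C ->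
  (forall k, k < n -> ~ halted (iter k (@step p) (C a))) ->
  C (iter n osucc a) = iter n (@step p) (C a).
Proof.
move=> rC; elim: n => // n IH nh; have {}IH := IH (fun k kn => nh k (ltnW kn)).
by rewrite (run_succ rC (osuccP _)) ?IH //; apply: nh.
Qed.

Lemma run_onext p z x (C : Ord -> config p) a : is_run z x C ->
  (forall k, ~ halted (C (iter k osucc a))) ->
  C (onext a) = Config Limit 0 (fun t i =>
    `[< forall n, exists2 k, n <= k & ctape (C (iter k osucc a)) t i >]).
Proof.
move=> rC nh; have al := onext_limit a.
have cov b : olt b (onext a) -> exists k, ole b (iter k osucc a) by move/olt_onext.
rewrite (run_limit rC al); last first.
  move=> b ba hb; have [k bk] := cov b ba; apply: (nh k.+1).
  have bk1 : olt b (iter k.+1 osucc a) by apply/olt_osucc.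
  by rewrite (run_halt rC bk1 hb).
congr Config; apply/funext => t; apply/funext => i; apply: asbool_equiv_eq.
split=> [h n|h b /cov[n bn]]; last first.
  have [k nk ck] := h n; exists (iter k osucc a); split=> //.
    exact: ole_trans bn (iter_osucc_mono _ nk).
  exact: onext_iter.
have [c [nc cb e]] := h _ (onext_iter a n).
have [k ck] := onext_between (ole_trans (ole_iter a n) nc) cb.
have [nk|kn] := leqP n k; first by exists k => //; rewrite -(is_run_oeq rC ck) e.
exists n => //; rewrite /is_true -e; congr (ctape _ t i); apply: (is_run_oeq rC).
by split=> //; apply: ole_trans (proj1 ck) (iter_osucc_mono _ (ltnW kn)).
Qed.

Arguments mexec : simpl never.

Section Stream.
Variable o : nat -> op.

(** [o] is laid out as a bit stream in which the [s]-th bit tells whether the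
    operation of index [s] modulo [#|op|] is to be performed. *)
Definition obits (t : nat) : bool :=
  (0 < t) && (enum_rank (o (t.-1 %/ #|{: op}|)) == t.-1 %% #|{: op}| :> nat).

Definition oparam : real := tp obits (fun _ _ => false) (fun=> false) Param.

Variable D0 : tape -> real.

Fixpoint mseq (n : nat) : mst :=
  if n is n'.+1 then mexec (o n') (mseq n') else (0, false, D0).

(** An operation moves the data pointer by at most one block but uses up [#|op|] blocks of the
    stream; so the data mark stays left of the instruction mark. *)
Lemma mseq_le n : (mseq n).1.1 <= n.
Proof.
elim: n => //= n; case: (mseq n) => [[j r] D] /=; rewrite /mexec => jn.
case: (o n) => //= *; try exact: leqW; by apply: leqW; apply: leq_trans (leq_pred _) _.
Qed.

Let L := #|{: op}|.

Lemma obitsE n k : k < L -> obits (n * L + k).+1 = (enum_rank (o n) == k :> nat).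
Proof.
by move=> kL; rewrite /obits /= divnMDl ?card_op_gt0 // divn_small // addn0 modnMDl modn_small.
Qed.

Lemma skips (P : (tape -> real) -> Prop) s d j r D c : P D -> j <= s ->
  (forall k, k < d -> obits (s + k).+1 = false) ->
  reach (dat obits P) (cfg obits (s + d) (j, r, D)) c ->
  reach (dat obits P) (cfg obits s (j, r, D)) c.
Proof.
move=> PD; elim: d s => [|d IH] s js us; first by rewrite addn0.
rewrite addnS -addSn => /IH h; apply: reach_trans (run_skip r PD js _) (h _ _).
- by have := us 0 isT; rewrite addn0.
- exact: leqW.
- by move=> k kd; rewrite addSnnS; apply: us.
Qed.

Lemma skips_after (P : (tape -> real) -> Prop) s d j r D c : P D -> j <= s ->
  (forall k, k < d -> obits (s + k).+1 = false) ->
  reach (dat obits P) c (cfg obits s (j, r, D)) ->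
  reach (dat obits P) c (cfg obits (s + d) (j, r, D)).
Proof.
move=> PD js; elim: d => [|d IH] us h; first by rewrite addn0.
rewrite addnS; apply: reach_trans (IH _ h) (run_skip _ PD _ (us d _)) => //.
  by move=> k kd; apply: us; exact: ltnW.
exact: leq_trans js (leq_addr _ _).
Qed.

Lemma frame_pre n : obits (n * L + enum_rank (o n)).+1 /\
  enum_val (cidx (n * L + enum_rank (o n))) = o n.
Proof.
rewrite obitsE ?eqxx //; split=> //.
rewrite -[RHS]enum_rankK; congr enum_val; apply: val_inj.
by rewrite /= modnMDl modn_small.
Qed.

Lemma run_frame n (P : (tape -> real) -> Prop) :
  op_ok (o n) (mseq n) -> P (mseq n).2 -> P (mseq n.+1).2 ->
  reach (dat obits P) (cfg obits (n * L) (mseq n)) (cfg obits (n.+1 * L) (mseq n.+1)).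
Proof.
move=> ok PD PD'; have [us eo] := frame_pre n.
have kL : enum_rank (o n) < L by [].
have jn : (mseq n).1.1 <= n * L.
  by apply: leq_trans (mseq_le n) _; rewrite leq_pmulr // card_op_gt0.
have jn1 : (mseq n.+1).1.1 <= (n * L + enum_rank (o n)).+1.
  apply: leq_trans (mseq_le n.+1) _; rewrite ltnS.
  by apply: leq_trans (leq_addr _ _); rewrite leq_pmulr // card_op_gt0.
move: jn jn1 ok PD PD'; rewrite /=; case: (mseq n) => [[j r] D] /= jn jn1 ok PD PD'.
apply: (@skips _ _ (enum_rank (o n))) => // [k kr|].
  by rewrite obitsE ?gtn_eqF //; apply: ltn_trans kr kL.
have -> : n.+1 * L = (n * L + enum_rank (o n)).+1 + (L - (enum_rank (o n)).+1).
  by rewrite -addnS -addnA subnKC // mulSnr.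
move: jn1 PD' (run_op (leq_trans jn (leq_addr _ _)) us eo ok PD PD').
case: (mexec _ _) => [[j' r'] D'] /= jn1 PD' h.
apply: skips_after => // k kd.
have kk : (enum_rank (o n)).+1 + k < L by rewrite -ltn_subRL.
rewrite addSn -addnA -addnS obitsE // ltn_eqF //.
by rewrite ltnS leq_addr.
Qed.

Lemma run_frame_halt n (P : (tape -> real) -> Prop) :
  o n = OHalt -> (mseq n).1.2 -> P (mseq n).2 ->
  exists c, [/\ reach (dat obits P) (cfg obits (n * L) (mseq n)) c, halted c &
    exists M, ctape c = tp obits (mseq n).2 M].
Proof.
move=> oh rn PD; have [us eo] := frame_pre n.
have jn : (mseq n).1.1 <= n * L.
  by apply: leq_trans (mseq_le n) _; rewrite leq_pmulr // card_op_gt0.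
move: jn rn PD; case: (mseq n) => [[j r] D] /= jn -> PD.
have [c [h1 h2 h3]] := run_halt_op (leq_trans jn (leq_addr _ _)) us (etrans eo oh) PD.
exists c; split=> //; apply: skips h1 => // k kr.
by rewrite obitsE ?gtn_eqF //; apply: ltn_trans kr (ltn_ord _).
Qed.

Lemma run_frames N d : (forall n, N <= n < N + d -> op_ok (o n) (mseq n)) ->
  exists n, [/\ d <= n,
    iter n (@step univ) (cfg obits (N * L) (mseq N)) = cfg obits ((N + d) * L) (mseq (N + d)) &
    forall k, k < n -> dat obits (fun D => exists2 n', N <= n' <= N + d & D = (mseq n').2)
      (iter k (@step univ) (cfg obits (N * L) (mseq N)))].
Proof.
elim: d => [|d IH] ok; first by exists 0; rewrite addn0.
have [|n [dn en hn]] := IH.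
  by move=> n /andP[Nn nd]; apply: ok; rewrite Nn addnS ltnW.
have okd : op_ok (o (N + d)) (mseq (N + d)).
  by apply: ok; rewrite leq_addr addnS leqnn.
have [||m [m0 em hm]] := @run_frame _ (fun D => exists2 n', N <= n' <= N + d.+1 & D = (mseq n').2) okd.
- by exists (N + d) => //; rewrite leq_addr leq_add2l leqnSn.
- by exists (N + d.+1); rewrite ?leq_addr ?leqnn // addnS.
exists (m + n); split; first by rewrite -[d.+1]add1n leq_add.
  by rewrite iterD en em addnS.
move=> k kmn; have [/hn[nh [D [M [[n' nn ->] e]]]]|nk] := ltnP k n.
  split=> //; exists (mseq n').2, M; split=> //; exists n' => //.
  by case/andP: nn => -> /leq_trans -> //; rewrite leq_add2l.
by rewrite -(subnK nk) iterD en; apply: hm; rewrite ltn_subLR // addnC.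
Qed.

(** The form of a configuration at the border of two periods: with all marks erased, the next period
    can start like the first one. *)
Definition clean (D : tape -> real) (c : config univ) : Prop :=
  [/\ cstate c = Start \/ cstate c = Limit, chead c = 0 &
      ctape c = tp obits D (fun=> false)].

Section Block.
Variables (x : real) (C : Ord -> config univ) (a : Ord).
Hypothesis rC : is_run oparam x C.
Hypothesis Ca : clean D0 (C a).

Lemma block_reach N : (forall n, n < N -> op_ok (o n) (mseq n)) ->
  exists n, [/\ N <= n,
    iter n (@step univ) (C a) = cfg obits (N * L) (mseq N) &
    forall k, k < n -> dat obits (fun D => exists2 n', n' <= N & D = (mseq n').2)
      (iter k (@step univ) (C a))].
Proof.
move=> ok; have [cs ch ct] := Ca.
have [|n [n0 en hn]] := @run_start obits _ D0
  (fun D => exists2 n', n' <= N & D = (mseq n').2) _ cs ch ct.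
  by exists 0.
have [|m [Nm em hm]] := @run_frames 0 N; first by move=> k /andP[_]; exact: ok.
rewrite add0n mul0n /= in em hm.
exists (m + n); split; first by rewrite ltnW // -[N.+1]addn1 leq_add.
  by rewrite iterD en em.
move=> k kmn; have [/hn//|nk] := ltnP k n.
rewrite -(subnK nk) iterD en.
have [|nh [D [M [[n' nn ->] e]]]] := hm (k - n); first by rewrite ltn_subLR // addnC.
by split=> //; exists (mseq n').2, M; split=> //; exists n'.
Qed.

Lemma block_halt N : (forall n, n < N -> op_ok (o n) (mseq n)) ->
  o N = OHalt -> (mseq N).1.2 ->
  exists k, halted (C (iter k osucc a)) /\
    exists M, ctape (C (iter k osucc a)) = tp obits (mseq N).2 M.
Proof.
move=> ok oh rN; have [n [Nn en hn]] := block_reach ok.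
have [c [[m [m0 em hm]] hc [M ec]]] := @run_frame_halt N (fun=> True) oh rN I.
have e : C (iter (m + n) osucc a) = c.
  rewrite (run_iter rC) ?iterD ?en // => k kmn.
  have [/hn[]//|nk] := ltnP k n.
  rewrite -(subnK nk) iterD en.
  by have [|] := hm (k - n); first by rewrite ltn_subLR // addnC.
by exists (m + n); rewrite e; split=> //; exists M.
Qed.

Hypothesis ok : forall n, op_ok (o n) (mseq n).

Lemma block_dat N : exists k0, forall k, k0 <= k ->
  dat obits (fun D => exists2 n, N <= n & D = (mseq n).2) (C (iter k osucc a)).
Proof.
have [n [Nn en hn]] := @block_reach N (fun n _ => ok n).
have nh k : ~ halted (iter k (@step univ) (C a)).
  have [m [km _ hm]] := @block_reach k.+1 (fun n _ => ok n).
  by have [] := hm k km.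
have eC k : C (iter k osucc a) = iter k (@step univ) (C a) 
  by apply: (run_iter rC) => k0 _; exact: nh.
exists n => k nk; rewrite eC -(subnK nk) iterD en.
have [m [km _ hm]] := @run_frames N (k - n).+1 (fun n _ => ok n).
have [nh' [D [M [[n' /andP[Nn' _] ->] e]]]] := hm (k - n) km.
by split=> //; exists (mseq n').2, M; split=> //; exists n'.
Qed.

Lemma block_all k : dat obits (fun D => exists n, D = (mseq n).2) (C (iter k osucc a)).
Proof.
have [n [Nn en hn]] := @block_reach k.+1 (fun n _ => ok n).
have eC : C (iter k osucc a) = iter k (@step univ) (C a).
  by apply: (run_iter rC) => k' k'k; have [] := hn k' (ltn_trans k'k Nn).
rewrite eC; have [nh [D [M [[n' _ ->] e]]]] := hn k Nn.
by split=> //; exists (mseq n').2, M; split=> //; exists n'.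
Qed.

(** If the data mark is away from each block infinitely often, every mark cell has limsup 1; the
    other tapes converge by hypothesis. *)
Lemma block_limit D' : (forall p N, exists2 n, N <= n & (mseq n).1.1 != p) ->
  (forall t i, t != Param -> exists N, forall n, N <= n -> (mseq n).2 t i = D' t i) ->
  clean D' (C (onext a)) /\ cstate (C (onext a)) = Limit.
Proof.
move=> jn Dn; rewrite (run_onext rC); last by move=> k; have [] := block_all k.
split=> //; split=> //=; first by right.
apply/funext => t; apply/funext => i.
have [->|tP] := eqVneq t Param; last first.
  have [N hN] := Dn t i tP; have [k0 hk] := block_dat N.
  have e k : k0 <= k -> ctape (C (iter k osucc a)) t i = D' t i.
    by move=> /hk[_ [D [M [[n Nn ->] ->]]]]; rewrite tp_data // hN.
  rewrite tp_data //; apply/asboolP/idP => [/(_ k0) [k /e <-]//|di n].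
  by exists (maxn k0 n); rewrite ?leq_maxr // e // leq_maxl.
rewrite /tp eqxx; case oi: (odd i); last first.
  have e k : ctape (C (iter k osucc a)) Param i = obits i./2.
    have [_ [D [M [_ ->]]]] := block_all k.
    by rewrite /tp eqxx oi.
  by apply/asboolP/idP => [/(_ 0)[k _]|di n]; [rewrite e|exists n => //; rewrite e].
apply: asboolT => n.
(* At the start of operation [m] the data mark is off block [i./2], and the instruction mark, in
   block [(m * L).+1], is already past it. *)
have [m nm jm] := jn i./2 (maxn n i./2).
have [k [mk ek hk]] := @block_reach m (fun n _ => ok n).
have eC : C (iter k osucc a) = iter k (@step univ) (C a).
  by apply: (run_iter rC) => k' k'k; have [] := hk k' k'k.
exists k; first by apply: leq_trans mk; apply: leq_trans nm; apply: leq_maxl.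
rewrite eC ek /= /tp eqxx oi /mk2 eq_sym (negbTE jm) /=.
rewrite ltn_eqF // ltnS.
have im : i./2 <= m by apply: leq_trans nm; apply: leq_maxr.
by apply: leq_trans im _; rewrite leq_pmulr // card_op_gt0.
Qed.

End Block.
End Stream.

(** * Streams of guarded assignments *)

Section Concatenation.
Variables (T : Type) (d : T) (l : nat -> seq T).
Hypothesis l_gt0 : forall n, 0 < size (l n).

Let pre n := flatten [seq l i | i <- iota 0 n].

(** As no list is empty, the first [k.+1] lists have more than [k] entries, and the default [d] is
    never returned. *)
Definition conc (k : nat) : T := nth d (pre k.+1) k.
Definition cpos (n : nat) : nat := size (pre n).

Lemma cposS n : cpos n.+1 = cpos n + size (l n).
Proof. by rewrite /cpos /pre -[n.+1]addn1 iotaD map_cat flatten_cat size_cat /= cats0. Qed.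

Lemma leq_cpos n : n <= cpos n.
Proof. by elim: n => // n IH; rewrite cposS -addn1 leq_add. Qed.

Lemma conc_cpos n k : k < size (l n) -> conc (cpos n + k) = nth d (l n) k.
Proof.
move=> kl; rewrite /conc.
have [m ->] : exists m, (cpos n + k).+1 = n.+1 + m.
  exists (cpos n + k - n); rewrite addSn subnKC //.
  exact: leq_trans (leq_cpos n) (leq_addr _ _).
rewrite /pre -addn1 -addnA iotaD map_cat flatten_cat nth_cat -/(cpos n).
by rewrite ltnNge leq_addr /= addKn nth_cat kl.
Qed.

Lemma cpos_mono m n : m <= n -> cpos m <= cpos n.
Proof.
move=> /subnKC <-; elim: (n - m) => [|j IH]; first by rewrite addn0.
by rewrite addnS cposS; apply: leq_trans IH (leq_addr _ _).
Qed.

Lemma cpos_locate k : exists n r, k = cpos n + r /\ r < size (l n).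
Proof.
elim: k => [|k [n [r [-> rn]]]]; first by exists 0, 0.
have [rn'|rn'] := ltnP r.+1 (size (l n)); first by exists n, r.+1; rewrite addnS.
exists n.+1, 0; split=> //; rewrite addn0 cposS -addnS; congr (_ + _).
by apply/eqP; rewrite eqn_leq rn.
Qed.

End Concatenation.

(** * Gates and their compilation to operations *)

Record gate := Gate {
  glits : seq (tape * nat * bool);
  (* [None] halts; [Some (t, i, v0, v1)] replaces 0 by [v0] and 1 by [v1] in
     cell [i] of [t]. *)
  gact : option (tape * nat * bool * bool) }.

Definition gguard (g : gate) (D : tape -> real) : bool :=
  all (fun l => D l.1.1 l.1.2 == l.2) (glits g).

Definition gexec (g : gate) (D : tape -> real) : tape -> real :=
  if gguard g D then
    if gact g is Some (t, i, v0, v1) then upd D t i (if D t i then v1 else v0) else D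
  else D.

Definition gate_ok (g : gate) : Prop :=
  (forall l, l \in glits g -> l.1.1 != Param) /\
  (if gact g is Some (t, _, _, _) then t != Param else true).

(** Every access returns to block 0, so that gates compile independently of each other. *)
Definition goto (i : nat) (o : op) : seq op :=
  nseq i./2 ORgt ++ o :: nseq i./2 OLft.

Definition gtests (g : seq (tape * nat * bool)) : seq op :=
  flatten [seq goto l.1.2 (OTest l.1.1 (odd l.1.2) l.2) | l <- g].

(* The initial detour makes the marked block change infinitely often. *)
Definition gpre (g : gate) : seq op :=
  [:: ORgt, OLft, OOne & gtests (glits g)].

Definition gpost (g : gate) : seq op :=
  if gact g is Some (t, i, v0, v1) then goto i (OSet t (odd i) v0 v1) else [:: OHalt].

Definition compile (g : gate) : seq op := gpre g ++ gpost g.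

Definition mrun (m : mst) (l : seq op) : mst := foldl (fun m o => mexec o m) m l.

Fixpoint run_ok (P : (tape -> real) -> Prop) (l : seq op) (m : mst) : Prop :=
  P m.2 /\ if l is o :: l' then op_ok o m /\ run_ok P l' (mexec o m) else True.

Lemma mrun_cat m l l' : mrun m (l ++ l') = mrun (mrun m l) l'.
Proof. exact: foldl_cat. Qed.

Lemma run_ok_cat P l l' m :
  run_ok P l m -> run_ok P l' (mrun m l) -> run_ok P (l ++ l') m.
Proof. by elim: l m => [|o l IH] m //= [Pm [ok /IH h]] /h. Qed.

Lemma run_ok_data P l m k : run_ok P l m -> P (mrun m (take k l)).2.
Proof. by elim: l m k => [|o l IH] m [|k] //= [Pm] // [_ /IH]; apply. Qed.

Lemma run_ok_op P l m k d : run_ok P l m -> k < size l ->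
  op_ok (nth d l k) (mrun m (take k l)).
Proof. by elim: l m k => [|o l IH] m [|k] //= [Pm] [//] _ /IH; apply. Qed.

Lemma mrun_goto i o r D : (forall j, (mexec o (j, r, D)).1.1 = j) ->
  mrun (0, r, D) (goto i o) =
    (0, (mexec o (i./2, r, D)).1.2, (mexec o (i./2, r, D)).2).
Proof.
move=> oj; rewrite /goto mrun_cat /=.
have -> n j : mrun (j, r, D) (nseq n ORgt) = (j + n, r, D).
  by elim: n j => [|n IH] j /=; rewrite ?addn0 // IH addSnnS.
rewrite add0n; have := oj i./2; case: (mexec _ _) => [[j r'] D'] /= ->.
by elim: i./2 => //= n IH; rewrite -[RHS]IH /mrun /=.
Qed.

Lemma run_ok_goto (P : (tape -> real) -> Prop) i o r D :
  (forall j, (mexec o (j, r, D)).1.1 = j) ->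
  op_ok o (i./2, r, D) -> P D -> P (mexec o (i./2, r, D)).2 ->
  run_ok P (goto i o) (0, r, D).
Proof.
move=> oj ok PD PD'; rewrite /goto.
have e n j : mrun (j, r, D) (nseq n ORgt) = (j + n, r, D).
  by elim: n j => [|n IH] j /=; rewrite ?addn0 // IH addSnnS.
apply: run_ok_cat.
  by elim: i./2 (0) => //= n IH j; do 2!split=> //; exact: IH.
rewrite e add0n /=; do 2!split=> //.
have := oj i./2; case: (mexec _ _) PD' => [[j r'] D'] /= PD' ->.
by elim: i./2 => //= n IH; do 2!split=> //; exact: IH.
Qed.

Lemma gtests_run lits r D : mrun (0, r, D) (gtests lits) =
  (0, r && all (fun l => D l.1.1 l.1.2 == l.2) lits, D).
Proof.
elim: lits r => [|[[t i] v] lits IH] r /=; first by rewrite andbT.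
rewrite /gtests /= mrun_cat mrun_goto // -/(gtests lits) /= IH.
by rewrite odd_double_half andbA.
Qed.

Lemma gtests_ok (P : (tape -> real) -> Prop) lits r D :
  (forall l, l \in lits -> l.1.1 != Param) -> P D -> run_ok P (gtests lits) (0, r, D).
Proof.
move=> + PD; elim: lits r => [|[[t i] v] lits IH] r lP //.
rewrite /gtests /= -/(gtests lits); apply: run_ok_cat.
  by apply: run_ok_goto => //=; apply: (lP (t, i, v)); rewrite inE eqxx.
rewrite mrun_goto //; apply: IH => l ll; apply: lP; by rewrite inE ll orbT.
Qed.

Lemma gpre_run g r D : mrun (0, r, D) (gpre g) = (0, gguard g D, D).
Proof. by rewrite /gpre /= gtests_run. Qed.

Lemma gpre_ok (P : (tape -> real) -> Prop) g r D :
  gate_ok g -> P D -> run_ok P (gpre g) (0, r, D).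
Proof. by move=> [gl _] PD; rewrite /gpre /=; do 6!split=> //; exact: gtests_ok. Qed.

Lemma compile_run g r D : exists r', mrun (0, r, D) (compile g) = (0, r', gexec g D).
Proof.
rewrite /compile mrun_cat gpre_run /gpost /gexec.
case: (gact g) => [[[[t i] v0] v1]|]; last first.
  by exists (gguard g D); case: (gguard g D).
by rewrite mrun_goto //= odd_double_half; eexists.
Qed.

Lemma compile_ok (P : (tape -> real) -> Prop) g r D :
  gate_ok g -> (gact g = None -> ~~ gguard g D) -> P D -> P (gexec g D) ->
  run_ok P (compile g) (0, r, D).
Proof.
move=> ok nh PD PD'; apply: run_ok_cat; first exact: gpre_ok.
rewrite gpre_run /gpost; have [_] := ok; move: PD' nh; rewrite /gexec.
case: (gact g) => [[[[t i] v0] v1]|] PD' nh ok'; last first.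
  by do 2!split=> //; apply: nh.
by apply: run_ok_goto => //=; rewrite odd_double_half.
Qed.

Section GateStream.
Variable gs : nat -> gate.
Hypothesis gs_ok : forall n, gate_ok (gs n).

Definition gstream : nat -> op := conc OOne (fun n => compile (gs n)).

Variable D0 : tape -> real.

Fixpoint gseq (n : nat) : tape -> real :=
  if n is n'.+1 then gexec (gs n') (gseq n') else D0.

Let pos := cpos (fun n => compile (gs n)).

Lemma compile_gt0 n : 0 < size (compile (gs n)).
Proof. by []. Qed.

Lemma mseq_pos n k : k <= size (compile (gs n)) ->
  mseq gstream D0 (pos n + k) =
    mrun (mseq gstream D0 (pos n)) (take k (compile (gs n))).
Proof.
elim: k => [|k IH] kn; first by rewrite addn0 take0.
rewrite addnS [LHS]/= IH ?(ltnW kn) // /gstream (conc_cpos _ compile_gt0) //.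
by rewrite (take_nth OOne) // -cats1 mrun_cat.
Qed.

Lemma mseq_gseq n : exists r, mseq gstream D0 (pos n) = (0, r, gseq n).
Proof.
elim: n => [|n [r IH]]; first by exists false.
rewrite /pos cposS mseq_pos // take_size IH.
have [r' ->] := compile_run (gs n) r (gseq n); by exists r'.
Qed.

Definition halting (n : nat) : bool := ~~ isSome (gact (gs n)) && gguard (gs n) (gseq n).

Lemma mseq_ok n k : ~~ halting n -> k < size (compile (gs n)) ->
  op_ok (gstream (pos n + k)) (mseq gstream D0 (pos n + k)) /\
  ((mseq gstream D0 (pos n + k)).2 = gseq n \/
   (mseq gstream D0 (pos n + k)).2 = gseq n.+1).
Proof.
move=> nh kn; have [r e] := mseq_gseq n.
have ng : gact (gs n) = None -> ~~ gguard (gs n) (gseq n).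
  by move=> gn; move: nh; rewrite /halting gn.
have h := @compile_ok (fun D => D = gseq n \/ D = gseq n.+1) (gs n) r (gseq n)
  (gs_ok n) ng (or_introl erefl) (or_intror erefl).
rewrite mseq_pos ?(ltnW kn) // e; split; last exact: run_ok_data h.
by rewrite /gstream (conc_cpos _ compile_gt0) //; apply: run_ok_op h kn.
Qed.

Lemma mseq_ok_all n : (forall n', n' < n -> ~~ halting n') ->
  forall k, k < pos n -> op_ok (gstream k) (mseq gstream D0 k).
Proof.
move=> nh k; have [m [r [-> rm]]] := cpos_locate compile_gt0 k => kn.
apply: (proj1 (mseq_ok _ rm)); apply: nh; rewrite ltnNge; apply/negP => nm.
by move: kn; rewrite ltnNge (leq_trans (cpos_mono (fun n => compile (gs n)) nm)) ?leq_addr.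
Qed.

Section GateBlock.
Variables (x : real) (C : Ord -> config univ) (a : Ord).
Hypothesis rC : is_run (oparam gstream) x C.
Hypothesis Ca : clean gstream D0 (C a).

Lemma gate_halt n : (forall n', n' < n -> ~~ halting n') -> halting n ->
  exists k, halted (C (iter k osucc a)) /\
    exists M, ctape (C (iter k osucc a)) = tp (obits gstream) (gseq n) M.
Proof.
move=> nh /andP[gn gg].
have gN : gact (gs n) = None by case: (gact (gs n)) gn.
have [r e] := mseq_gseq n.
have sz : size (compile (gs n)) = (size (gpre (gs n))).+1.
  by rewrite /compile size_cat /gpost gN addn1.
have e' : mseq gstream D0 (pos n + size (gpre (gs n))) = (0, true, gseq n).
  by rewrite mseq_pos ?sz // e /compile take_size_cat // gpre_run gg.
have [||| k [hk [M eM]]] := @block_halt _ _ _ _ _ rC Ca (pos n + size (gpre (gs n))).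
- move=> k; have [kn _|nk] := ltnP k (pos n); first exact: (mseq_ok_all nh kn).
  rewrite -(subnKC nk) ltn_add2l => kn.
  rewrite mseq_pos ?sz ?(ltnW (leqW kn)) // e /gstream (conc_cpos _ compile_gt0) ?sz ?(leqW kn) //.
  rewrite /compile nth_cat kn takel_cat ?(ltnW kn) //.
  by apply: (@run_ok_op (fun=> True)) => //; apply: gpre_ok.
- rewrite /gstream (conc_cpos _ compile_gt0) ?sz //.
  by rewrite /compile nth_cat ltnn subnn /gpost gN.
- by rewrite e'.
- by exists k; split=> //; exists M; rewrite eM e'.
Qed.

Hypothesis nh : forall n, ~~ halting n.

Lemma mseq_ok' k : op_ok (gstream k) (mseq gstream D0 k).
Proof.
by have [n [r [-> rn]]] := cpos_locate compile_gt0 k; apply: (proj1 (mseq_ok _ rn)).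
Qed.

Lemma gate_all k : ~ halted (C (iter k osucc a)) /\ exists n M,
  ctape (C (iter k osucc a)) = tp (obits gstream) (gseq n) M.
Proof.
have [hk [D [M [[n ->] e]]]] := block_all rC Ca mseq_ok' k.
split=> //; have [m [r [en rm]]] := cpos_locate compile_gt0 n.
have [_] := mseq_ok (nh m) rm; rewrite -en => -[eD|eD].
  by exists m, M; rewrite e eD.
by exists m.+1, M; rewrite e eD.
Qed.

Lemma gate_limit D' :
  (forall t i, t != Param -> exists N, forall n, N <= n -> gseq n t i = D' t i) ->
  clean gstream D' (C (onext a)) /\ cstate (C (onext a)) = Limit.
Proof.
move=> h; apply: (block_limit rC Ca mseq_ok') => [p N|t i tP].
  have [r e] := mseq_gseq N.
  (* A gate starts with the pointer at block 0 and has it at block 1 after the initial [ORgt]; one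
     of these two blocks is not [p]. *)
  have [p0|p0] := eqVneq p 0; last first.
    by exists (pos N); [exact: leq_cpos|rewrite e eq_sym].
  exists (pos N + 1); first exact: leq_trans (leq_cpos _ _) (leq_addr _ _).
  by rewrite mseq_pos // e p0.
have [N hN] := h t i tP; exists (pos N) => n.
have [m [r [-> rm]]] := cpos_locate compile_gt0 n => Nn.
have Nm : N <= m.
  rewrite leqNgt; apply/negP => /(cpos_mono (fun n => compile (gs n))) mN.
  have := leq_trans mN Nn.
  by rewrite cposS leq_add2l leqNgt rm.
have [_ [->|->]] := mseq_ok (nh m) rm; apply: hN => //; exact: leqW.
Qed.

End GateBlock.
End GateStream.

(** * One machine simulates any open process *)

Arguments Cantor.to_nat : simpl never.
Arguments Cantor.of_nat : simpl never.
Arguments gseq : simpl never.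

Lemma pair_le_to_nat m n : m <= Cantor.to_nat (m, n).
Proof. by have := Cantor.to_nat_spec m n; nia. Qed.

Section Simulation.
Variables (I : countType) (F : (nat + I -> bool) -> I -> Prop).
Hypothesis opF : forall i, opn (F^~ i).
Variables (out : nat -> I) (h : I).

Local Notation lits := (seq ((nat + I) * bool)).

Definition sat (u : nat + I -> bool) (l : lits) : bool :=
  all (fun p => u p.1 == p.2) l.

Definition forces (i : I) (l : lits) : bool := `[< forall u, sat u l -> F u i >].

(** Here openness enters: the next bit becomes a countable disjunction of finite tests, and the
    table [forces] can be stored in the parameter. *)
Lemma forcesP u i : F u i <-> exists l, forces i l /\ sat u l.
Proof.
split=> [/opF[K HK]|[l [/asboolP fl]]]; last exact: fl.
exists [seq (k, u k) | k <- K]; split; last by apply/allP => _ /mapP[k _ ->] /=.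
apply/asboolP => v /allP sv; apply: HK => k kK; apply/eqP; rewrite eq_sym.
by apply: (sv (k, u k)); apply/mapP; exists k.
Qed.

(** Cell 0 of [Work] is a flag: a period of length omega starts by flipping it;
    if it has become 0, the next state is computed into the [scrc] cells;
    otherwise they are copied to the [valc] and [Output] cells. *)
Definition valc (i : I) : nat := (pickle i).*2.+1.
Definition scrc (i : I) : nat := (pickle i).*2.+2.

Definition addr (k : nat + I) : tape * nat :=
  match k with inl j => (Input, j) | inr i => (Work, valc i) end.

Definition peek (D : tape -> real) : nat + I -> bool :=
  fun k => D (addr k).1 (addr k).2.

Inductive act := AZero (i : I) | ATest (i : I) (l : lits)
  | AVal (i : I) (v : bool) | AOut (k : nat) (v : bool) | ANop.

(** [AVal] and [AOut] write [v] only if the scratch bit is [v], so a cell whose value does not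
    change is never disturbed. The guards of [ANop] contradict each other. *)
Definition act_gate (a : act) : gate :=
  match a with
  | AZero i => Gate [:: (Work, 0, false)] (Some (Work, scrc i, false, false))
  | ATest i l => Gate ((Work, 0, false) :: [seq (addr p.1, p.2) | p <- l])
      (Some (Work, scrc i, true, true))
  | AVal i v => Gate [:: (Work, 0, true); (Work, scrc i, v)] (Some (Work, valc i, v, v))
  | AOut k v => Gate [:: (Work, 0, true); (Work, scrc (out k), v)] (Some (Output, k, v, v))
  | ANop => Gate [:: (Work, 0, true); (Work, 0, false)] (Some (Work, 0, true, true))
  end.

Definition act_exec (a : act) (D : tape -> real) : tape -> real :=
  match a with
  | AZero i => if ~~ D Work 0 then upd D Work (scrc i) false else D
  | ATest i l => if ~~ D Work 0 && sat (peek D) l then upd D Work (scrc i) true else D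
  | AVal i v => if D Work 0 && (D Work (scrc i) == v) then upd D Work (valc i) v else D
  | AOut k v => if D Work 0 && (D Work (scrc (out k)) == v) then upd D Output k v else D
  | ANop => D
  end.

Lemma act_gateE a D : gexec (act_gate a) D = act_exec a D.
Proof.
rewrite /gexec /gguard; case: a => [i|i l|i v|k v|] /=.
- by rewrite andbT eqbF_neg if_same.
- by rewrite all_map eqbF_neg if_same.
- by rewrite andbT eqb_id if_same.
- by rewrite andbT eqb_id if_same.
- by case: (D Work 0).
Qed.

(** The reset of scratch cell [i] has the single position [pickle i * 4]. As the pairing dominates
    its first argument, all tests for [i] come later. *)
Definition act_at (n : nat) : act :=
  let m := n %/ 4 in
  let: (a, b) := Cantor.of_nat m in
  match n %% 4 with
  | 0 => oapp AZero ANop (pickle_inv m)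
  | 1 => match pickle_inv a, unpickle b with
         | Some i, Some l => if forces i l then ATest i l else ANop
         | _, _ => ANop
         end
  | 2 => oapp (AVal^~ (odd b)) ANop (pickle_inv a)
  | _ => AOut a (odd b)
  end.

Lemma act_at_test i l : forces i l ->
  act_at (Cantor.to_nat (pickle i, pickle l) * 4 + 1) = ATest i l.
Proof.
move=> fl; transitivity (match pickle_inv (pickle i), unpickle (pickle l) with
    | Some i, Some l => if forces i l then ATest i l else ANop
    | _, _ => ANop end); last by rewrite pickleK_inv pickleK fl.
by rewrite /act_at divnMDl // modnMDl (divn_small (isT : 1 < 4)) addn0 Cantor.cancel_of_to.
Qed.

Lemma act_at_zero i : act_at (pickle i * 4) = AZero i.
Proof. by rewrite /act_at mulnK // modnMl pickleK_inv; case: Cantor.of_nat. Qed.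

Lemma act_at_val i v : exists n, act_at n = AVal i v.
Proof.
exists (Cantor.to_nat (pickle i, v : nat) * 4 + 2).
rewrite /act_at divnMDl // modnMDl /= addn0 Cantor.cancel_of_to pickleK_inv /=.
by case: v.
Qed.

Lemma act_at_out k v : exists n, act_at n = AOut k v.
Proof.
exists (Cantor.to_nat (k, v : nat) * 4 + 3).
by rewrite /act_at divnMDl // modnMDl /= addn0 Cantor.cancel_of_to; case: v.
Qed.

Lemma act_at_zeroP n i : act_at n = AZero i -> n = pickle i * 4.
Proof.
rewrite {2}(divn_eq n 4) /act_at; case: Cantor.of_nat => a b.
case: (n %% 4) => [|[|[|k]]] //.
- rewrite addn0; have := @pickle_invK I (n %/ 4).
  by case: pickle_inv => //= j e [<-]; rewrite e.
- by case: pickle_inv => // j; case: unpickle => // l; case: ifP.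
- by case: pickle_inv.
Qed.

Lemma act_at_testP n i l : act_at n = ATest i l -> forces i l /\ pickle i * 4 < n.
Proof.
rewrite {2}(divn_eq n 4) /act_at; case E : Cantor.of_nat => [a b].
case: (n %% 4) => [|[|[|k]]] //.
- by case: pickle_inv.
- have := @pickle_invK I a; case: pickle_inv => // j; rewrite [oapp _ _ _]/= => e; case: unpickle => // l'.
  case: ifP => // fl [<- <-]; split=> //; rewrite addn1 ltnS leq_mul2r /=.
  have -> : pickle j = a by [].
  by rewrite -(Cantor.cancel_to_of (n %/ 4)) E pair_le_to_nat.
- by case: pickle_inv.
Qed.

(** Halting is tested only at the start of a computing period, when [Work] and [Output] show the
    same process state. *)
Definition sim_gates (n : nat) : gate :=
  match n with
  | 0 => Gate [::] (Some (Work, 0, true, false))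
  | 1 => Gate [:: (Work, 0, false); (Work, valc h, true)] None
  | n.+2 => act_gate (act_at n)
  end.

Lemma sim_gates_ok n : gate_ok (sim_gates n).
Proof.
have WP : Work != Param by apply/eqP.
have IP : Input != Param by apply/eqP.
have OP : Output != Param by apply/eqP.
case: n => [|[|n]] //=; first by split=> // l; rewrite !inE => /orP[]/eqP->.
case: (act_at n) => [i|i l|i v|k v|]; split=> //= p; rewrite !inE.
- by move=> /eqP->.
- by move=> /orP[/eqP->//|/mapP[[[j|j] b] _ ->]].
- by move=> /orP[]/eqP->.
- by move=> /orP[]/eqP->.
- by move=> /orP[]/eqP->.
Qed.

Lemma upd_same D t c v : upd D t c v t c = v.
Proof. by rewrite /upd !eqxx. Qed.

Lemma upd_other D t c v t' c' : (t', c') <> (t, c) -> upd D t c v t' c' = D t' c'.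
Proof. by rewrite /upd; case: eqP => [->|]; case: eqP => [->|]. Qed.

Lemma upd_cell D t c v c' : c' <> c -> upd D t c v t c' = D t c'.
Proof. by move=> cc; apply: upd_other => /(congr1 snd). Qed.

Lemma valc_scrc i j : valc i <> scrc j.
Proof. by rewrite /valc /scrc; lia. Qed.

Lemma valc_inj i j : valc i = valc j -> i = j.
Proof. by rewrite /valc => e; apply: (pcan_inj pickleK); lia. Qed.

Lemma scrc_inj i j : scrc i = scrc j -> i = j.
Proof. by rewrite /scrc => e; apply: (pcan_inj pickleK); lia. Qed.

Lemma act_flag a D : act_exec a D Work 0 = D Work 0.
Proof.
by case: a => [i|i l|i v|k v|] //=; case: ifP => // _; rewrite upd_other.
Qed.

Section SimPeriod.
Variable D : tape -> real.

Local Notation G := (gseq sim_gates D).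

Lemma G1 : G 1 = upd D Work 0 (~~ D Work 0).
Proof. by rewrite /gseq /gexec /=; case: (D Work 0). Qed.

Lemma G2 : G 2 = G 1.
Proof. by rewrite {1}/gseq {1}/gexec /=; case: ifP. Qed.

Lemma GS n : G n.+3 = act_exec (act_at n) (G n.+2).
Proof. by rewrite -act_gateE. Qed.

Lemma G_flag n : G n.+1 Work 0 = ~~ D Work 0.
Proof.
case: n => [|n]; first by rewrite G1 upd_same.
by elim: n => [|n IH]; [rewrite G2 G1 upd_same|rewrite GS act_flag].
Qed.

Lemma G1_keep t c : (t, c) <> (Work, 0) -> G 1 t c = D t c.
Proof. by move=> tc; rewrite G1 upd_other. Qed.

Lemma G_keep t c n : (t, c) <> (Work, 0) ->
  (forall m, act_exec (act_at m) (G m.+2) t c = G m.+2 t c) -> G n t c = D t c.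
Proof.
move=> tc keep; case: n => [//|[|n]]; first exact: G1_keep.
by elim: n => [|n IH]; [rewrite G2 G1_keep|rewrite GS keep].
Qed.

Definition G_cvg t c v := exists N, forall n, N <= n -> G n t c = v.

Lemma G_cvg_keep t c : (t, c) <> (Work, 0) ->
  (forall m, act_exec (act_at m) (G m.+2) t c = G m.+2 t c) -> G_cvg t c (D t c).
Proof. by move=> tc keep; exists 0 => n _; apply: G_keep. Qed.

Lemma G_cvg_fun : (forall t c, exists v, G_cvg t c v) ->
  exists D', forall t c, G_cvg t c (D' t c).
Proof.
move=> cv; exists (fun t c => projT1 (cid (cv t c))) => t c.
by case: cid.
Qed.

Lemma G_cvg_uniq t c v v' : G_cvg t c v -> G_cvg t c v' -> v = v'.
Proof.
by move=> [N hN] [N' hN']; rewrite -(hN (maxn N N')) ?leq_maxl // hN' // leq_maxr.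
Qed.

Lemma G_cvg_flag : G_cvg Work 0 (~~ D Work 0).
Proof. by exists 1 => -[//|n] _; exact: G_flag. Qed.

Section Compute.
Hypothesis D0 : D Work 0 = true.

Lemma comp_step t c m : (forall i, (t, c) <> (Work, scrc i)) ->
  act_exec (act_at m) (G m.+2) t c = G m.+2 t c.
Proof.
move=> tc; have f : G m.+2 Work 0 = false by rewrite G_flag D0.
case: (act_at m) => [i|i l|i v|k v|] //=; rewrite f //=; last case: ifP => // _.
all: by rewrite upd_other.
Qed.

Lemma comp_keep t c n : (t, c) <> (Work, 0) -> (forall i, (t, c) <> (Work, scrc i)) ->
  G n t c = D t c.
Proof. by move=> tc0 tc; apply: G_keep => // m; exact: comp_step. Qed.

Lemma comp_peek n : peek (G n) = peek D.
Proof.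
apply/funext => -[j|i]; rewrite /peek /=; apply: comp_keep => //.
by move=> j /(congr1 snd) /valc_scrc.
Qed.

(** After its reset, the scratch cell can only be set by a successful test, and the tests see the
    old values throughout. *)
Lemma comp_sound i n : pickle i * 4 < n -> G n.+2 Work (scrc i) -> F (peek D) i.
Proof.
elim: n => [//|n IH]; rewrite ltnS leq_eqVlt GS => /orP[/eqP e|lt].
  by rewrite -e act_at_zero /= G_flag D0 /= upd_same.
case E : (act_at n) => [j|j l|j v|k v|] /=; rewrite ?G_flag ?D0 /=; try exact: IH lt.
- have [/scrc_inj->|ne] := pselect (scrc i = scrc j); first by rewrite upd_same.
  by rewrite upd_cell //; exact: IH lt.
- case: ifP => [sl|_]; last exact: IH lt.
  have [/scrc_inj ij|ne] := pselect (scrc i = scrc j); last first.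
    by rewrite upd_cell //; exact: IH lt.
  move=> _; apply/forcesP; exists l; rewrite -(comp_peek n.+2) sl ij.
  by have [] := act_at_testP E.
Qed.

Lemma comp_complete i : F (peek D) i ->
  exists N, forall n, N <= n -> G n.+2 Work (scrc i).
Proof.
move=> /forcesP[l [fl sl]]; have e := act_at_test fl.
set N := (_ + 1) in e; have [_ lN] := act_at_testP e.
exists N.+1 => n /subnKC <-; elim: (n - N.+1) => [|k IH].
  by rewrite addn0 GS e /= G_flag D0 comp_peek sl /= upd_same.
rewrite addnS GS; case E : (act_at (N.+1 + k)) => [j|j l'|j v|k' v|] /=;
  rewrite ?G_flag ?D0 //=.
(* The only reset of this cell precedes the test, so it cannot undo it. *)
- have [/scrc_inj ij|ne] := pselect (scrc i = scrc j); last by rewrite upd_cell.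
  have := act_at_zeroP E; rewrite -ij => e'.
  by move: lN; rewrite -e' ltnNge addSn leqW // leq_addr.
- case: ifP => // _; have [->|ne] := pselect (scrc i = scrc j); first by rewrite upd_same.
  by rewrite upd_cell.
Qed.

Lemma comp_scr i : G_cvg Work (scrc i) `[< F (peek D) i >].
Proof.
have [Fi|nF] := pselect (F (peek D) i).
  have [N hN] := comp_complete Fi; rewrite asboolT //.
  by exists N.+2 => -[|[|n]] // nN; exact: hN.
rewrite asboolF //; exists (pickle i * 4).+3 => -[|[|n]] // nN.
by apply/negP => /(comp_sound _) /nF.
Qed.

Lemma comp_cvg t c : exists v, G_cvg t c v.
Proof.
have [e|ne] := pselect ((t, c) = (Work, 0)).
  by case: e => -> ->; exists (~~ D Work 0); exact: G_cvg_flag.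
have [[i e]|ns] := pselect (exists i, (t, c) = (Work, scrc i)).
  by case: e => -> ->; eexists; exact: comp_scr.
exists (D t c); apply: G_cvg_keep => // m; apply: comp_step => i e.
by apply: ns; exists i.
Qed.

End Compute.

Section Commit.
Hypothesis D0 : D Work 0 = false.

Lemma comm_keep t c n : (t, c) <> (Work, 0) ->
  (forall i, (t, c) <> (Work, valc i)) -> (forall k, (t, c) <> (Output, k)) ->
  G n t c = D t c.
Proof.
move=> tc0 tv tk; apply: G_keep => // m.
by case: (act_at m) => [i|i l|i v|k v|] //=; rewrite G_flag D0 //=;
   case: ifP => // _; rewrite upd_other.
Qed.

Lemma comm_scr i n : G n Work (scrc i) = D Work (scrc i).
Proof. by apply: comm_keep => // j /(congr1 snd) /esym /valc_scrc. Qed.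

Lemma comm_val i n :
  G n Work (valc i) = D Work (valc i) \/ G n Work (valc i) = D Work (scrc i).
Proof.
case: n => [|[|n]]; [by left|by left; rewrite G1_keep|].
elim: n => [|n IH]; first by left; rewrite G2 G1_keep.
rewrite GS.
case: (act_at n) => [j|j l|j v|k v|] //=; rewrite G_flag D0 //= comm_scr;
  case: eqP => // e; last by rewrite upd_other.
have [/valc_inj ij|ne] := pselect (valc i = valc j).
  by right; rewrite ij upd_same.
by rewrite upd_cell.
Qed.

Lemma comm_out k n :
  G n Output k = D Output k \/ G n Output k = D Work (scrc (out k)).
Proof.
case: n => [|[|n]]; [by left|by left; rewrite G1_keep|].
elim: n => [|n IH]; first by left; rewrite G2 G1_keep.
rewrite GS.
case: (act_at n) => [j|j l|j v|k' v|] //=; rewrite G_flag D0 //= comm_scr;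
  case: eqP => // e; first by rewrite upd_other.
have [->|ne] := pselect (k = k'); first by right; rewrite upd_same.
by rewrite upd_cell.
Qed.

Lemma comm_cvg_val i : G_cvg Work (valc i) (D Work (scrc i)).
Proof.
have [N e] := act_at_val i (D Work (scrc i)).
exists N.+3 => n /subnKC <-; elim: (n - N.+3) => [|d IH].
  by rewrite addn0 GS e /= G_flag D0 comm_scr eqxx /= upd_same.
rewrite addnS 3!addSn GS; move: IH; rewrite 3!addSn => IH.
case: (act_at _) => [j|j l|j v|k v|] //=; rewrite G_flag D0 //= comm_scr;
  case: eqP => // e'; last by rewrite upd_other.
have [/valc_inj ij|ne] := pselect (valc i = valc j).
  by rewrite ij upd_same.
by rewrite upd_cell.
Qed.

Lemma comm_cvg_out k : G_cvg Output k (D Work (scrc (out k))).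
Proof.
have [N e] := act_at_out k (D Work (scrc (out k))).
exists N.+3 => n /subnKC <-; elim: (n - N.+3) => [|d IH].
  by rewrite addn0 GS e /= G_flag D0 comm_scr eqxx /= upd_same.
rewrite addnS 3!addSn GS; move: IH; rewrite 3!addSn => IH.
case: (act_at _) => [j|j l|j v|k' v|] //=; rewrite G_flag D0 //= comm_scr;
  case: eqP => // e'; first by rewrite upd_other.
have [->|ne] := pselect (k = k'); first by rewrite upd_same.
by rewrite upd_cell.
Qed.

Lemma comm_cvg t c : exists v, G_cvg t c v.
Proof.
have [e|ne] := pselect ((t, c) = (Work, 0)).
  by case: e => -> ->; exists (~~ D Work 0); exact: G_cvg_flag.
have [[i e]|ns] := pselect (exists i, (t, c) = (Work, valc i)).
  by case: e => -> ->; eexists; exact: comm_cvg_val.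
have [[k e]|nk] := pselect (exists k, (t, c) = (Output, k)).
  by case: e => -> ->; eexists; exact: comm_cvg_out.
exists (D t c), 0 => n _; apply: comm_keep => // [i e|k e].
  by apply: ns; exists i.
by apply: nk; exists k.
Qed.

End Commit.
End SimPeriod.
End Simulation.

(** * Correctness of the simulation *)

Section SimulationRun.
Variables (I : countType) (F : (nat + I -> bool) -> I -> Prop).
Hypothesis opF : forall i, opn (F^~ i).
Variables (out : nat -> I) (h : I).

Local Notation gates := (sim_gates F out h).
Local Notation os := (gstream gates).
Local Notation TP := (tp (obits os)).

Definition sim_param : real := oparam os.

Variables (x : real) (C : Ord -> config univ).
Hypothesis rC : is_run sim_param x C.

Local Notation ok := (sim_gates_ok F out h).

Lemma compute_period a D : clean os D (C a) -> D Work 0 = true ->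
  D Work (valc h) = false ->
  (exists D', [/\ clean os D' (C (onext a)), D' Work 0 = false,
     D' Input = D Input, D' Output = D Output &
     forall i : I, D' Work (valc i) = D Work (valc i) /\
               D' Work (scrc i) = `[< F (peek D) i >]]) /\
  forall k, exists E M, [/\ ctape (C (iter k osucc a)) = TP E M,
     E Input = D Input, E Output = D Output &
     forall i : I, E Work (valc i) = D Work (valc i)].
Proof.
move=> Ca D0 Dh.
have nh n : ~~ halting gates D n.
  case: n => [|[|n]] //; last by rewrite /halting /=; case: (act_at F n).
  by rewrite /halting /gguard /= G_flag D0 /= G1_keep ?Dh // => /(congr1 snd).
have kI n : gseq gates D n Input = D Input.
  by apply/funext => j; apply: comp_keep.
have kO n : gseq gates D n Output = D Output.
  by apply/funext => j; apply: comp_keep.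
have kV n (i : I) : gseq gates D n Work (valc i) = D Work (valc i).
  by apply: comp_keep => // j e; apply: (@valc_scrc I i j); exact: (congr1 snd e).
split; last first.
  move=> k; have [_ [n [M e]]] := gate_all ok rC Ca nh k.
  by exists (gseq gates D n), M.
have [D' cv] := G_cvg_fun (comp_cvg opF out h D0).
have [c1 _] := gate_limit ok rC Ca nh (fun t i _ => cv t i).
exists D'; split => //.
- by rewrite (G_cvg_uniq (cv _ _) (G_cvg_flag F out h D)) D0.
- by apply/funext => j; apply: (G_cvg_uniq (cv _ _)); exists 0 => n _; rewrite kI.
- by apply/funext => j; apply: (G_cvg_uniq (cv _ _)); exists 0 => n _; rewrite kO.
- move=> i; split; last exact: (G_cvg_uniq (cv _ _) (comp_scr opF out h D0 i)).
  by apply: (G_cvg_uniq (cv _ _)); exists 0 => n _; rewrite kV.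
Qed.

Lemma commit_period a D : clean os D (C a) -> D Work 0 = false ->
  (exists D', [/\ clean os D' (C (onext a)), D' Work 0 = true,
     D' Input = D Input, forall k, D' Output k = D Work (scrc (out k)) &
     forall i : I, D' Work (valc i) = D Work (scrc i)]) /\
  forall k, exists E M, [/\ ctape (C (iter k osucc a)) = TP E M,
     E Input = D Input,
     forall k, E Output k = D Output k \/ E Output k = D Work (scrc (out k)) &
     forall i : I, E Work (valc i) = D Work (valc i) \/
               E Work (valc i) = D Work (scrc i)].
Proof.
move=> Ca D0.
have nh n : ~~ halting gates D n.
  case: n => [|[|n]] //; last by rewrite /halting /=; case: (act_at F n).
  by rewrite /halting /gguard /= G_flag D0.
have kI n : gseq gates D n Input = D Input.
  by apply/funext => j; apply: comm_keep.
split; last first.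
  move=> k; have [_ [n [M e]]] := gate_all ok rC Ca nh k.
  exists (gseq gates D n), M; split=> // [k'|i].
    exact: comm_out.
  exact: comm_val.
have [D' cv] := G_cvg_fun (comm_cvg F out h D0).
have [c1 _] := gate_limit ok rC Ca nh (fun t i _ => cv t i).
exists D'; split => //.
- by rewrite (G_cvg_uniq (cv _ _) (G_cvg_flag F out h D)) D0.
- by apply/funext => j; apply: (G_cvg_uniq (cv _ _)); exists 0 => n _; rewrite kI.
- by move=> k; exact: (G_cvg_uniq (cv _ _) (comm_cvg_out F out h D0 k)).
- by move=> i; exact: (G_cvg_uniq (cv _ _) (comm_cvg_val F out h D0 i)).
Qed.

Lemma halt_period a D : clean os D (C a) -> D Work 0 = true ->
  D Work (valc h) = true ->
  exists b, halted (C b) /\ ctape (C b) Output = D Output.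
Proof.
move=> Ca D0 Dh.
have [||k [hk [M eM]]] := @gate_halt _ ok _ _ _ _ rC Ca 1.
- by case.
- by rewrite /halting /gguard /= G_flag D0 /= G1_keep ?Dh // => /(congr1 snd).
exists (iter k osucc a); split=> //; rewrite eM; apply/funext => j.
by rewrite tp_data ?G1_keep //; apply/eqP.
Qed.

Let nx t := onext (onext t).
Let nx_mono t t' : ole t t' -> ole (nx t) (nx t').
Proof. by move=> tt'; do 2!apply: ole_onext. Qed.
Let nx_gt t : olt t (nx t).
Proof. exact: olt_trans (onext_gt _) (onext_gt _). Qed.

(* As the flag is 0 initially, the first period only copies zeros. *)
Definition stime : Ord -> Ord := grow nx (onext ozero).

Local Notation S := (proc F x).

Definition encodes (a : Ord) (D : tape -> real) : Prop :=
  [/\ D Work 0 = true, D Input = x, forall k, D Output k = S a (out k) &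
      forall i : I, D Work (valc i) = S a i].

(** The invariant inside the simulation of one step. A 1 seen there is a 1 of the process at [b] or
    [osucc b], so intermediate stages do not falsify limsups. *)
Definition between (b : Ord) (D : tape -> real) : Prop :=
  [/\ D Input = x,
     forall k, D Output k = S b (out k) \/ D Output k = S (osucc b) (out k) &
     forall i : I, D Work (valc i) = S b i \/ D Work (valc i) = S (osucc b) i].

Lemma sim_step t b D : clean os D (C t) -> encodes b D -> S b h = false ->
  (exists2 D', clean os D' (C (nx t)) & encodes (osucc b) D') /\
  forall t', ole t t' -> olt t' (nx t) -> exists E M,
    ctape (C t') = TP E M /\ between b E.
Proof.
move=> Ct [D0 DI DO DV] Sh.
have [[D1 [c1 f1 I1 O1 V1]] all1] := compute_period Ct D0 (etrans (DV h) Sh).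
have [[D2 [c2 f2 I2 O2 V2]] all2] := commit_period c1 f1.
have pk : peek D = join x (S b).
  by apply/funext => -[j|i]; rewrite /peek /= ?DI ?DV.
have scrE (i : I) : D1 Work (scrc i) = S (osucc b) i.
  by rewrite (procS _ _ _ (osuccP b)) -pk; have [] := V1 i.
split.
  exists D2 => //; split=> // [|k|i]; first by rewrite I2 I1.
    by rewrite O2 scrE.
  by rewrite V2 scrE.
move=> t' tt' t'n; have [tn|/nolt tn] := pselect (olt t' (onext t)).
  have [k ek] := onext_between tt' tn; rewrite (is_run_oeq rC ek).
  have [E [M [e EI EO EV]]] := all1 k; exists E, M; split=> //.
  by split=> [|k'|i]; [rewrite EI|left; rewrite EO DO|left; rewrite EV DV].
have [k ek] := onext_between tn t'n; rewrite (is_run_oeq rC ek).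
have [E [M [e EI EO EV]]] := all2 k; exists E, M; split=> //.
split=> [|k'|i]; first by rewrite EI I1.
  by have [->|->] := EO k'; [left; rewrite O1 DO|right; rewrite scrE].
by have [->|->] := EV i; [left; have [-> _] := V1 i|right; rewrite scrE].
Qed.

Lemma clean_nhalted D c : clean os D c -> ~ halted c.
Proof. by case=> + _ _; rewrite /halted => -[->|->]. Qed.

(** The halting bit has to be 0 before [a], since otherwise the machine has stopped earlier. *)
Lemma sim_inv a : (forall b, olt b a -> S b h = false) ->
  exists2 D, clean os D (C (stime a)) & encodes a D.
Proof.
elim/(well_founded_ind olt_wf): a => a IH Sh.
have {}IH b : olt b a -> exists2 D, clean os D (C (stime b)) & encodes b D.
  by move=> ba; apply: (IH b ba) => c cb; apply: Sh; exact: olt_trans cb ba.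
case: (ord_cases a) => [a0|[b sb]|al].
- have e : oeq (stime a) (onext ozero) by exact: grow0.
  pose D := (fun t => if t is Input then x else fun=> false) : tape -> real.
  have C0 : C ozero = init_config univ sim_param x by apply: (run_zero rC is_ozeroP).
  have c0 : clean os D (C ozero).
    rewrite C0; split; [by left|by []|rewrite /=].
    apply/funext => t; apply/funext => i; rewrite /tp; case: eqP => [->|].
      by rewrite /sim_param /oparam /tp eqxx.
    by case: t.
  have [[D' [c1 f1 I1 O1 V1]] _] := commit_period c0 erefl.
  exists D'; first by rewrite (is_run_oeq rC e).
  by split=> // [k|i]; rewrite ?O1 ?V1 proc0.
- have ba : olt b a by case: sb.
  have [D cD eD] := IH b ba.
  have [[D' cD' eD'] _] := sim_step cD eD (Sh b ba).
  exists D'.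
    by rewrite (is_run_oeq rC (growS _ nx_mono nx_gt sb)).
  have ab : oeq a (osucc b).
    by split; [apply: is_osucc_ole sb (olt_succ b)|apply: is_osucc_ole (osuccP b) ba].
  by move: eD'; rewrite /encodes (proc_oeq _ _ ab).
have gl : is_olimit (stime a) by exact: growL.
have cof t : olt t (stime a) -> exists2 b, olt b a & olt t (stime b).
  by move=> ta; apply: grow_cofinal.
have nh t : olt t (stime a) -> ~ halted (C t).
  move=> /cof[b /IH[D /clean_nhalted nhb _] tb] ht.
  by apply: nhb; rewrite (run_halt rC tb ht).
have blk b t : olt b a -> ole (stime b) t -> olt t (stime a) ->
    exists2 c, ole b c /\ olt c a & exists E M, ctape (C t) = TP E M /\ between c E.
  move=> ba bt ta.
  have [c ct tc] := grow_div nx_mono nx_gt (ole_trans (grow_ge _ nx_mono b) bt).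
  have bc : ole b c.
    apply/nolt => cb; apply: (@olt_irr t); apply: olt_ole_trans tc _.
    by apply: ole_trans bt; apply: grow_nx.
  have ca : olt c a.
    apply: contrapT => /nolt ac; apply: (@olt_irr t); apply: olt_ole_trans ta _.
    by apply: ole_trans ct; apply: grow_mono.
  exists c => //; have [D cD eD] := IH c ca.
  by have [_] := sim_step cD eD (Sh c ca); apply.
pose D := ctape (limit_config C (stime a)).
have DE t i : D t i = `[< olimsup (fun c => ctape (C c) t i) (stime a) >] by [].
have at_ b : olt b a -> olt (stime b) (stime a) by exact: grow_lt.
have Dsame t i v b : olt b a ->
    (forall c, ole (stime b) c -> olt c (stime a) -> ctape (C c) t i = v) -> D t i = v.
  move=> ba cv; rewrite DE (asbool_equiv_eq (olimsup_const (w := v) (at_ b ba) cv)).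
  by rewrite asboolb.
have [[b0 b0a] _] := al.
(* A 1 in the period of [c] is a 1 of the process at [c] or [osucc c], both below [a]; conversely,
   the process state at [d] is displayed at [stime d]. Hence the two limsups agree. *)
have Dlim t i j : t != Param ->
    (forall b E, between b E -> E t i = S b j \/ E t i = S (osucc b) j) ->
    (forall b E, encodes b E -> E t i = S b j) -> D t i = S a j.
  move=> tP hb he; rewrite DE procL //; apply: asbool_equiv_eq; split=> hl b ba.
    have [t' [bt' t'a vt']] := hl _ (at_ b ba).
    have [c [bc ca] [E [M [e /hb btw]]]] := blk b t' ba bt' t'a.
    have {}vt' : E t i by move: vt'; rewrite e tp_data.
    move: vt'; case: btw => -> vt'; first by exists c.
    exists (osucc c); split=> //; last exact: olimit_osucc.
    exact: ole_trans bc (oltW (olt_succ c)).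
  have [c ca bc] := cof b ba.
  have [d [cd da vd]] := hl c ca.
  exists (stime d); split; last first.
  - have [E [_ _ ->] /he eE] := IH d da.
    by rewrite tp_data // eE.
  - exact: at_.
  - by apply: ole_trans (oltW bc) _; apply: grow_mono.
exists D.
  rewrite (run_limit rC gl nh); split; [by right|by []|].
  apply/funext => t; apply/funext => i; rewrite -/D /tp.
  case: eqP => // ->; case oi: (odd i).
    rewrite DE; apply: asboolT => b /cof[c ca bc].
    exists (stime c); split; [exact: oltW|exact: at_|].
    by have [E [_ _ ->] _] := IH c ca; rewrite /tp eqxx oi.
  apply: (Dsame _ _ _ b0 b0a) => c bc ca.
  have [d _ [E [M [-> _]]]] := blk b0 c b0a bc ca.
  by rewrite /tp eqxx oi.
split.
(* The flag is 1 at every [stime c], hence 1 in the limit, so that a computing period follows. *)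
- rewrite DE; apply: asboolT => b /cof[c ca bc].
  exists (stime c); split; [exact: oltW|exact: at_|].
  have [E [_ _ ->] [f _ _ _]] := IH c ca; rewrite tp_data //; exact/eqP.
- apply/funext => i; apply: (Dsame _ _ _ b0 b0a) => c bc ca.
  have [d _ [E [M [-> [EI _ _]]]]] := blk b0 c b0a bc ca.
  by rewrite tp_data ?EI //; apply/eqP.
- move=> k; apply: Dlim; first exact/eqP.
    by move=> b E [_ + _]; apply.
  by move=> b E [_ _ + _]; apply.
- move=> i; apply: Dlim; first exact/eqP.
    by move=> b E [_ _]; apply.
  by move=> b E [_ _ _]; apply.
Qed.

Lemma sim_shows a (y : real) : (forall b, S b h = false) ->
  (forall b, ole a b -> forall k, S b (out k) = y k) ->
  forall t, ole (stime a) t -> ctape (C t) Output = y.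
Proof.
move=> Sh ay t at_; apply/funext => k.
have [c ct tc] := grow_div nx_mono nx_gt (ole_trans (grow_ge _ nx_mono a) at_).
have ac : ole a c.
  apply/nolt => ca; apply: (@olt_irr t); apply: olt_ole_trans tc _.
  by apply: ole_trans at_; apply: grow_nx.
have [D cD eD] := sim_inv (fun b (_ : olt b c) => Sh b).
have [_ /(_ t ct tc) [E [M [-> [_ EO _]]]]] := sim_step cD eD (Sh c).
rewrite tp_data; last exact/eqP.
by have [->|->] := EO k; apply: ay => //; apply: ole_trans ac (oltW (olt_succ c)).
Qed.

Lemma sim_halts (y : real) : (exists a, S a h) ->
  (forall a, S a h -> forall k, S a (out k) = y k) ->
  exists b, halted (C b) /\ ctape (C b) Output = y.
Proof.
move=> /olt_ex_min[a ah amin] ay.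
have [D cD [f _ DO DV]] := sim_inv (fun b ba => negbTE (introN idP (amin b ba))).
have [b [hb eb]] := halt_period cD f (etrans (DV h) ah).
by exists b; split=> //; rewrite eb; apply/funext => k; rewrite DO ay.
Qed.

End SimulationRun.

Theorem open_process_sim (I : countType) (F : (nat + I -> bool) -> I -> Prop)
    (out : nat -> I) (h : I) : (forall i, opn (F^~ i)) ->
  exists p z, forall x y,
    ((forall a, proc F x a h = false) ->
     (exists a, forall b, ole a b -> forall k, proc F x b (out k) = y k) ->
     eventually_shows p z x y) /\
    ((exists a, proc F x a h) ->
     (forall a, proc F x a h -> forall k, proc F x a (out k) = y k) ->
     halts_with p z x y).
Proof.
move=> opF; exists univ, (sim_param F out h) => x y; split=> [Sh [a ay]|ex ay].
  exists (run univ (sim_param F out h) x); first exact: runP.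
  exists (stime a) => t; exact: (sim_shows opF (runP _ _ _) Sh ay).
exists (run univ (sim_param F out h) x); first exact: runP.
by have [b hb] := sim_halts opF (runP _ _ _) ex ay; exists b.
Qed.

(** * Families of machines as open processes *)

(** Codes in [nat] make the type of bits independent of the program. *)
Definition scode n (q : state n) : nat :=
  match q with Start => 0 | Limit => 1 | Halt => 2 | Aux i => i.+3 end.

Lemma scode_inj n : injective (@scode n).
Proof. by move=> [|||i] [|||j] //= [] /val_inj ->. Qed.

Definition is_halt n (q : state n) : bool := scode q == 2.

Lemma haltedP p (c : config p) : reflect (halted c) (is_halt (cstate c)).
Proof. by apply: (iffP eqP) => [e|->//]; apply: scode_inj. Qed.

(** Bits of a configuration: a tape cell, "the head is at [i] in the state of
    code [q]", "the machine has halted". *)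
Definition cbit := ((tape * nat) + (nat * nat) + unit)%type.

Definition enc p (c : config p) (k : cbit) : bool :=
  match k with
  | inl (inl (t, i)) => ctape c t i
  | inl (inr (i, q)) => (chead c == i) && (scode (cstate c) == q)
  | inr _ => is_halt (cstate c)
  end.

Definition fstep p (c : config p) : config p :=
  if is_halt (cstate c) then c else step c.

(** For a fixed state and head position, a bit after one step depends only on the cells under the
    head and on its own cell, hence continuously on the tapes. *)
Lemma enc_fstep_local p (q : state (nstates p)) i (T T' : tape -> real) k :
  (forall t, T t i = T' t i) ->
  (if k is inl (inl (t, j)) then T t j = T' t j else True) ->
  enc (fstep (@Config p q i T)) k = enc (fstep (@Config p q i T')) k.
Proof.
move=> Ti Tk; have e : (fun t => T t i) = (fun t => T' t i) by apply/funext.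
rewrite /fstep /=; case: ifP => _.
  by case: k Tk => [[[t j]|[j q']]|] /=.
rewrite /step /= e; case: (delta q _) => [[q' w] mv].
by case: k Tk => [[[t j] /= ->|[j s]]|].
Qed.

Section Family.
Variables (p_ : nat -> program) (z_ : nat -> real).

Definition fbit := (nat * cbit + nat * nat)%type.

Definition Tp n t i : nat + fbit := inr (inl (n, inl (inl (t, i)))).
Definition Mk n i q : nat + fbit := inr (inl (n, inl (inr (i, q)))).
Definition Hb n : nat + fbit := inr (inl (n, inr tt)).
Definition fl0 : nat + fbit := inr (inr (0, 0)).
Definition fl1 : nat + fbit := inr (inr (0, 1)).
Definition aux k j : nat + fbit := inr (inr (k.+1, j)).

Definition tapes n (u : nat + fbit -> bool) : tape -> real := fun t i => u (Tp n t i).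

Definition at_limit (u : nat + fbit -> bool) : bool := u fl0 && u fl1.
Definition at_zero (u : nat + fbit -> bool) : bool := ~~ u fl0 && ~~ u fl1.

Variables (rst : nat -> (nat + fbit -> bool) -> bool).
Variables (src : nat -> (nat + fbit -> bool) -> real).
Variables (FA : (nat + fbit -> bool) -> nat -> nat -> Prop).

(** The machines [(p_ n, z_ n)] run in parallel; machine [n] is restarted on
    input [src n] whenever [rst n] holds. The two flags alternate at successor
    stages, hence are both set exactly at limits. *)
Definition family (u : nat + fbit -> bool) (i : fbit) : Prop :=
  match i with
  | inl (n, k) =>
      if rst n u then is_true (enc (init_config (p_ n) (z_ n) (src n u)) k)
      else if at_limit u && ~~ u (Hb n) then
        is_true (enc (fstep (@Config (p_ n) Limit 0 (tapes n u))) k)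
      else exists c : nat * state (nstates (p_ n)), u (Mk n c.1 (scode c.2)) /\
        enc (fstep (@Config (p_ n) c.2 c.1 (tapes n u))) k
  | inr (0, 0) => ~~ (u fl0 && ~~ u fl1)
  | inr (0, _) => u fl0 && ~~ u fl1
  | inr (k.+1, j) => FA u k j
  end.

Section FamilyOpen.
Hypothesis rst_cont : forall n, cont (rst n).
Hypothesis src_cont : forall n i, cont (fun u => src n u i).
Hypothesis FA_open : forall k j, opn (fun u => FA u k j).

Lemma enc_fstep_cont n q i k :
  cont (fun u => enc (fstep (@Config (p_ n) q i (tapes n u))) k).
Proof.
move=> u; exists ([:: Tp n Input i; Tp n Work i; Tp n Output i; Tp n Param i] ++
  (if k is inl (inl (t, j)) then [:: Tp n t j] else [::])) => v uv.
apply: enc_fstep_local => [t|].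
  by apply: uv; rewrite mem_cat; case: t; rewrite !inE eqxx ?orbT.
case: k uv => [[[t j]|//]|//] uv; apply: uv.
by rewrite mem_cat mem_seq1 eqxx orbT.
Qed.

(** The clause for a running machine is open but not continuous, as it searches all head positions
    and states. *)
Lemma family_open i : opn (family^~ i).
Proof.
case: i => [[n k]|[[|k] j]]; last exact: FA_open.
- apply: opn_if => //.
    apply: cont_opn; case: k => [[[t j]|[j s]]|[]] /=.
    + by case: t; [exact: src_cont|exact: cont_cst..].
    + exact: cont_cst.
    + exact: cont_cst.
  apply: opn_if.
  + apply: (cont_comp2 (fun a b => a && ~~ b)); last exact: cont_bit.
    by apply: (cont_comp2 andb); exact: cont_bit.
  + by apply: cont_opn; exact: enc_fstep_cont.
  + apply: opn_ex => c; apply: opn_and; apply: cont_opn; first exact: cont_bit.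
    exact: enc_fstep_cont.
- have cc : cont (fun u : nat + fbit -> bool => u fl0 && ~~ u fl1).
    by apply: (cont_comp2 (fun a b => a && ~~ b)); exact: cont_bit.
  case: j => [|j]; apply: cont_opn => //; exact: (cont_comp negb cc).
Qed.

End FamilyOpen.

Variable x : real.

Definition fstate (a : Ord) : nat + fbit -> bool := join x (proc family x a).

Local Notation S := fstate.

Lemma fstate_oeq a b : oeq a b -> S a = S b.
Proof. by rewrite /fstate => /proc_oeq ->. Qed.

Lemma fstate0 a i : is_ozero a -> S a (inr i) = false.
Proof. by move=> a0; rewrite /fstate /= proc0. Qed.

Lemma fstateS b a i : is_osucc b a -> S a (inr i) = `[< family (S b) i >].
Proof. by move=> sb; rewrite /fstate /= (procS _ _ _ sb). Qed.

Lemma fstateL a i : is_olimit a -> S a (inr i) = `[< olimsup (fun b => S b (inr i)) a >].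
Proof. by move=> al; rewrite /fstate /= procL. Qed.

Lemma fstate_const i c a (v : bool) : is_olimit a -> olt c a ->
  (forall b, ole c b -> olt b a -> S b (inr i) = v) -> S a (inr i) = v.
Proof.
move=> al ca cv; rewrite fstateL // (asbool_equiv_eq (olimsup_const ca cv)).
by rewrite asboolb.
Qed.

Lemma fl0S b a : is_osucc b a -> S a fl0 = ~~ (S b fl0 && ~~ S b fl1).
Proof. by move=> sb; rewrite {1}/fl0 (fstateS _ sb) asboolb. Qed.

Lemma fl1S b a : is_osucc b a -> S a fl1 = S b fl0 && ~~ S b fl1.
Proof. by move=> sb; rewrite {1}/fl1 (fstateS _ sb) asboolb. Qed.

Lemma at_limit_succ b a : is_osucc b a -> at_limit (S a) = false.
Proof.
move=> sb; rewrite /at_limit (fl0S sb) (fl1S sb).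
by case: (S b fl0); case: (S b fl1).
Qed.

Lemma at_zero_succ b a : is_osucc b a -> at_zero (S a) = false.
Proof.
move=> sb; rewrite /at_zero (fl0S sb) (fl1S sb).
by case: (S b fl0); case: (S b fl1).
Qed.

Lemma at_limit_limit a : is_olimit a -> at_limit (S a).
Proof.
(* One of the two stages after [b] has the flags [v] and [~~ v]; so each flag is 1 cofinally
   often. *)
move=> al; have H b v : olt b a ->
    exists c, [/\ ole b c, olt c a & S c fl0 = v /\ S c fl1 = ~~ v].
  move=> ba; have b1 := osuccP b; have b2 := osuccP (osucc b).
  have ba1 := olimit_osucc al ba; have ba2 := olimit_osucc al ba1.
  have le1 : ole b (osucc b) := oltW (olt_succ b).
  have le2 : ole b (osucc (osucc b)) := ole_trans le1 (oltW (olt_succ _)).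
  case: (boolP (S (osucc b) fl0 == v)) => [/eqP e|/eqP e].
    exists (osucc b); split=> //; split=> //; move: e.
    by rewrite (fl0S b1) (fl1S b1) => <-; rewrite negbK.
  exists (osucc (osucc b)); split=> //; move: e.
  rewrite (fl0S b2) (fl1S b2) (fl0S b1) (fl1S b1).
  by case: (S b fl0); case: (S b fl1); case: v.
apply/andP; split; rewrite fstateL //; apply: asboolT => b ba.
  by have [c [bc ca [e _]]] := H b true ba; exists c.
by have [c [bc ca [_ e]]] := H b false ba; exists c.
Qed.

Lemma at_zero_zero a : is_ozero a -> at_zero (S a).
Proof. by move=> a0; rewrite /at_zero !fstate0. Qed.

Lemma at_zeroP a : ~ is_ozero a -> at_zero (S a) = false.
Proof.
case: (ord_cases a) => [//|[b /at_zero_succ->//]|/at_limit_limit] /andP[+ _] _.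
by rewrite /at_zero => ->.
Qed.

(** At limits, the bits [Mk] of a machine that has not halted are garbage. *)
Definition rep n (u : nat + fbit -> bool) (c : config (p_ n)) : Prop :=
  [/\ forall t i, u (Tp n t i) = ctape c t i, u (Hb n) = is_halt (cstate c) &
      if at_limit u && ~~ u (Hb n) then cstate c = Limit /\ chead c = 0
      else forall i q, u (Mk n i q) = (chead c == i) && (scode (cstate c) == q)].

Lemma rep_enc n u (c : config (p_ n)) : at_limit u && ~~ u (Hb n) = false ->
  (forall k, u (inr (inl (n, k))) = enc c k) -> rep u c.
Proof.
by move=> nl e; split=> [t i||]; [exact: e|exact: e|rewrite nl => i q; exact: e].
Qed.

Lemma rep_step n b a c : is_osucc b a -> rst n (S b) = false ->
  rep (S b) c -> rep (S a) (fstep c : config (p_ n)).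
Proof.
move=> sb nr [rt rh rm]; apply: rep_enc => [|k].
  by rewrite (at_limit_succ sb).
rewrite (fstateS _ sb) /= nr; case: c rt rh rm => q i T /= rt rh rm.
have -> : tapes n (S b) = T by apply/funext => t; apply/funext => j; exact: rt.
move: rm; case: ifP => [_ [-> ->]|_ rm]; first by rewrite asboolb.
apply/asboolP/idP => [[[i' q']] /=|e]; last first.
  by exists (i, q); split=> //=; rewrite rm !eqxx.
by rewrite rm => -[/andP[/eqP <- /eqP /scode_inj <-]].
Qed.

Lemma rep_init n b a : is_osucc b a -> rst n (S b) ->
  rep (S a) (init_config (p_ n) (z_ n) (src n (S b))).
Proof.
move=> sb r; apply: rep_enc => [|k]; first by rewrite (at_limit_succ sb).
by rewrite (fstateS _ sb) /= r asboolb.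
Qed.

Lemma family_run n b e : is_osucc b e -> rst n (S b) ->
  (forall c, ole e c -> rst n (S c) = false) ->
  forall d, rep (S (oadd e d)) (run (p_ n) (z_ n) (src n (S b)) d).
Proof.
move=> sb rb nr; set v := src n (S b); have rv := runP (p_ n) (z_ n) v.
elim/(well_founded_ind olt_wf) => d IH.
case: (ord_cases d) => [d0|[d' sd]|dl].
- rewrite (fstate_oeq (oadd0 e d0)) (run_zero rv d0).
  exact: rep_init.
- have -> : run (p_ n) (z_ n) v d = fstep (run (p_ n) (z_ n) v d').
    rewrite /fstep; case: haltedP => hd; last exact: (run_succ rv sd).
    by apply: (run_halt rv) => //; case: sd.
  apply: (rep_step (oaddS e sd)); first by apply: nr; exact: oadd_ge.
  by apply: IH; case: sd.
have el := oaddL e dl.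
have [[d0 d0d] _] := dl.
have stage c : ole e c -> olt c (oadd e d) -> exists2 d', olt d' d & oeq c (oadd e d').
  move=> ec ced; have [d' cd'] := oadd_sub ec; exists d' => //.
  apply: contrapT => /nolt /(oadd_le e) dd'; apply: (@olt_irr c).
  exact: olt_ole_trans ced (ole_trans dd' (proj2 cd')).
(* If the machine has halted before the limit, all its bits have been constant since, so even the
   bits [Mk] survive the limsup. *)
have [[d1 [d1d hd1]]|nh] := pselect (exists d1, olt d1 d /\ halted (run (p_ n) (z_ n) v d1)).
  rewrite (run_halt rv d1d hd1).
  have ce c : ole (oadd e d1) c -> olt c (oadd e d) ->
      forall k, S c (inr (inl (n, k))) = enc (run (p_ n) (z_ n) v d1) k.
    move=> d1c cd; have [d2 d2d cd2] := stage c (ole_trans (oadd_ge e d1) d1c) cd.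
    have d12 : ole d1 d2 by apply/(@oadd_le_inv e)/(ole_trans d1c)/(proj1 cd2).
    have -> : run (p_ n) (z_ n) v d1 = run (p_ n) (z_ n) v d2.
      have [d21|d12'] := ole_total d2 d1; first exact: (is_run_oeq rv).
      by rewrite (run_halt rv d12' hd1).
    have hd2 : halted (run (p_ n) (z_ n) v d2).
      have [d21|d12'] := ole_total d2 d1; first by rewrite -(is_run_oeq rv (conj d12 d21)).
      by rewrite (run_halt rv d12' hd1).
    rewrite (fstate_oeq cd2); have [rt rh] := IH d2 d2d.
    have -> : S (oadd e d2) (Hb n) by rewrite rh; apply/haltedP.
    by rewrite andbF => rm [[[t i]|[i q]]|[]] //=; [exact: rt|exact: rm].
  apply: rep_enc => [|k]; last first.
    by apply: (fstate_const el (oadd_lt e d1d)) => c c1 c2; apply: ce.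
  have -> : S (oadd e d) (Hb n) = true; last by rewrite andbF.
  apply: (fstate_const el (oadd_lt e d1d)) => c c1 c2; rewrite ce //=.
  exact/haltedP.
have nh' c : olt c d -> ~ halted (run (p_ n) (z_ n) v c).
  by move=> cd hc; apply: nh; exists c.
have hbF : S (oadd e d) (Hb n) = false.
  apply: (fstate_const el (oadd_lt e d0d)) => c c1 c2.
  have [d2 d2d cd2] := stage c (ole_trans (oadd_ge e d0) c1) c2.
  rewrite (fstate_oeq cd2); have [_ -> _] := IH d2 d2d.
  by apply/negbTE/haltedP/nh'.
rewrite (run_limit rv dl nh'); split=> [t i||]; last by rewrite hbF at_limit_limit.
  rewrite /Tp fstateL //; apply: asbool_equiv_eq; split=> hl c cd.
    have [c' [cc' c'd Sc']] := hl _ (oadd_lt e cd).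
    have [d2 d2d cd2] := stage c' (ole_trans (oadd_ge e c) cc') c'd.
    exists d2; split=> //; first by apply/(@oadd_le_inv e)/(ole_trans cc')/(proj1 cd2).
    by have [<- _ _] := IH d2 d2d; rewrite -(fstate_oeq cd2).
  have [|d2 d2d cd2] := @grow_cofinal osucc e _ d c dl cd; first exact: ole_osucc.
  have [d3 [d23 d3d e3]] := hl d2 d2d.
  exists (oadd e d3); split; last by have [-> _ _] := IH d3 d3d.
    by apply: ole_trans (oltW cd2) _; exact: oadd_le.
  exact: oadd_lt.
by rewrite hbF.
Qed.

Lemma family_bits n b e c : is_osucc b e -> rst n (S b) ->
  (forall c, ole e c -> rst n (S c) = false) -> ole e c ->
  exists2 d, oeq c (oadd e d) &
    let r := run (p_ n) (z_ n) (src n (S b)) d in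
    (forall i, S c (Tp n Output i) = ctape r Output i) /\ S c (Hb n) = is_halt (cstate r).
Proof.
move=> sb rb nr ec; have [d cd] := oadd_sub ec; exists d => // r.
rewrite (fstate_oeq cd); have [rt rh _] := family_run sb rb nr d; by split.
Qed.

End Family.

(** * Closure properties of computable functions *)

(** [m = true]: infinite time computable; [m = false]: eventually computable. *)
Definition computable (m : bool) (f : real -> real) : Prop :=
  if m then it_computable f else it_eventually_computable f.

(** A halted run stays frozen, so halting too can be stated about all later stages, and both modes
    take one form. *)
Definition settles (m : bool) p (z x y : real) : Prop :=
  exists a, forall b, ole a b ->
    ctape (run p z x b) Output = y /\ (m -> halted (run p z x b)).

Lemma computable_settles m f : computable m f ->
  exists p z, forall x, settles m p z x (f x).
Proof.
case: m => -[p [z pz]]; exists p, z => x; have [C rC [a]] := pz x;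
  rewrite (run_unique rC (runP _ _ _)).
  move=> [ha <-]; exists a => b ab; have rr := runP p z x.
  have -> : run p z x b = run p z x a.
    have [ba|ab'] := ole_total b a; last exact: (run_halt rr ab' ha).
    exact: (is_run_oeq rr).
  by split.
by move=> ca; exists a => b /ca.
Qed.

Lemma settles_halted p z x y a : settles true p z x y ->
  halted (run p z x a) -> ctape (run p z x a) Output = y.
Proof.
move=> [b hb] ha; have rr := runP p z x.
have [ba|ab] := ole_total b a; first by have [] := hb a ba.
by rewrite -(run_halt rr ab ha); have [] := hb b (ole_refl b).
Qed.

Lemma halted_mono p z x a b : ole a b -> halted (run p z x a) -> 
  run p z x b = run p z x a.
Proof.
move=> ab ha; have rr := runP p z x.
have [ba|ab'] := ole_total b a; last exact: (run_halt rr ab' ha).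
exact: (is_run_oeq rr).
Qed.

Lemma computable_process m (I : countType) (F : (nat + I -> bool) -> I -> Prop)
    (out : nat -> I) (h : I) (f : real -> real) : (forall i, opn (F^~ i)) ->
  (if m then forall x, (exists a, proc F x a h) /\
      forall a, proc F x a h -> forall k, proc F x a (out k) = f x k
   else forall x, (forall a, proc F x a h = false) /\
      exists a, forall b, ole a b -> forall k, proc F x b (out k) = f x k) ->
  computable m f.
Proof.
move=> oF H; have [p [z sim]] := open_process_sim out h oF; move: H.
case: m => H; exists p, z => x; have [h1 h2] := H x; have [s1 s2] := sim x (f x).
  exact: s2.
exact: s1.
Qed.

Lemma computableW m f : computable true f -> computable m f.
Proof.
case: m => // -[p [z pz]]; exists p, z => x; have [C rC [a [ha <-]]] := pz x.
exists C => //; exists a => b ab; have [ba|ab'] := ole_total b a.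
  by rewrite (is_run_oeq rC (conj ab ba)).
by rewrite (run_halt rC ab' ha).
Qed.

(** A single process step evaluates all conditions; the bit [None], set by the same step, is the
    halting bit. *)
Lemma open_computable m (P : real -> nat -> Prop) :
  (forall k, opn (fun x : real => P x k)) ->
  computable m (fun x k => `[< P x k >]).
Proof.
move=> oP; apply: computableW.
pose F (u : nat + option nat -> bool) i :=
  if i is Some k then P (fun j => u (inl j)) k else True.
apply: (@computable_process true _ F Some None) => [[k|]|x].
- move=> u /oP[K hK]; exists [seq inl j | j <- K] => v uv; apply: hK => j jK.
  by apply: uv; apply: map_f.
- exact: opn_cst.
have o1 := osuccP ozero; split.
  by exists (osucc ozero); rewrite (procS _ _ _ o1); apply: asboolT.
move=> a ha k; have [b ba _] := proc_origin ha; have za : olt ozero a.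
  by apply: ole_olt_trans ba; exact: is_ozero_le is_ozeroP.
by apply: (proc_const za) => c _ _; rewrite /F /=; split=> [/asboolP|/asboolP].
Qed.

Lemma fstate_origin p_ z_ rst src FA x a i :
  fstate p_ z_ rst src FA x a (inr i) ->
  exists2 b, olt b a & family p_ z_ rst src FA (fstate p_ z_ rst src FA x b) i.
Proof. exact: proc_origin. Qed.

Lemma fstate_constF p_ z_ rst src FA x a c i (v : bool) : olt c a ->
  (forall b, ole c b -> olt b a -> 
     (family p_ z_ rst src FA (fstate p_ z_ rst src FA x b) i <-> v)) ->
  fstate p_ z_ rst src FA x a (inr i) = v.
Proof. exact: proc_const. Qed.

Lemma ole_olub A (k : A -> Ord) i : ole (k i) (olub k).
Proof. by apply/oltP => c ci; apply/olt_olub; exists i. Qed.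

(** * Countable pairing *)

Section Pairing.
Variables (m : bool) (g : nat -> real -> real).
Variables (p_ : nat -> program) (z_ : nat -> real).
Hypothesis pg : forall n x, settles m (p_ n) (z_ n) x (g n x).

Let rst (n : nat) (u : nat + fbit -> bool) : bool := at_zero u.
Let src (n : nat) (u : nat + fbit -> bool) : real := fun i => u (inl i).
(** That all machines have halted is not an open condition: [aux 0] records that some machine still
    runs, and [aux 1] negates this one step later. The flags exclude stage 0, where [aux 0 0] is 0
    only by initialization. *)
Let FA (u : nat + fbit -> bool) (k j : nat) : Prop :=
  match k with
  | 0 => exists n, ~~ u (Hb n)
  | _ => [&& m, u fl0 || u fl1 & ~~ u (aux 0 0)]
  end.
Let out (k : nat) : fbit :=
  let: (n, j) := Cantor.of_nat k in inl (n, inl (inl (Output, j))).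

Let e := osucc ozero.

Lemma pairing_open i : opn ((family p_ z_ rst src FA)^~ i).
Proof.
apply: family_open => [n|n k|[|k] j].
- by apply: (cont_comp2 (fun a b => ~~ a && ~~ b)); exact: cont_bit.
- exact: cont_bit.
- apply: opn_ex => n; apply: cont_opn; apply: (cont_comp negb); exact: cont_bit.
- apply: cont_opn; apply: (cont_comp2 (fun a b => [&& m, a & ~~ b])); last exact: cont_bit.
  by apply: (cont_comp2 orb); exact: cont_bit.
Qed.

Section PairingRun.
Variable x : real.
Local Notation S := (fstate p_ z_ rst src FA x).

Lemma pairing_bits n c : ole e c -> exists2 d, oeq c (oadd e d) &
  (forall i, S c (Tp n Output i) = ctape (run (p_ n) (z_ n) x d) Output i) /\
  S c (Hb n) = is_halt (cstate (run (p_ n) (z_ n) x d)).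
Proof.
move=> ec; have o1 := osuccP ozero.
apply: (@family_bits p_ z_ rst src FA x n ozero e c o1) => //.
  exact: at_zero_zero is_ozeroP.
move=> c' ec'; apply: at_zeroP => /(_ ozero); apply.
exact: olt_ole_trans (olt_succ _) ec'.
Qed.

Lemma pairing_cvg : exists2 a, ole e a & forall c, ole a c -> forall n,
  (forall i, S c (Tp n Output i) = g n x i) /\ (m -> S c (Hb n)).
Proof.
pose a n := projT1 (cid (pg n x)).
have aP n b : ole (a n) b -> _ := projT2 (cid (pg n x)) b.
exists (olub (fun n => oadd e (a n))).
  exact: ole_trans (oadd_ge e (a 0)) (ole_olub (fun n => oadd e (a n)) 0).
move=> c ac n; have an := ole_trans (ole_olub (fun n => oadd e (a n)) n) ac.
have [d cd [cO cH]] := pairing_bits n (ole_trans (oadd_ge e (a n)) an).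
have [dO dH] := aP n d (oadd_le_inv (ole_trans an (proj1 cd))).
by split=> [i|/dH hd]; [rewrite cO dO|rewrite cH; apply/haltedP].
Qed.

End PairingRun.

Lemma pairing_computable : computable m (fun x k =>
  let: (n, j) := Cantor.of_nat k in g n x j).
Proof.
(* The halting bit [inr (2, 0)] is [aux 1 0]. *)
apply: (@computable_process m _ _ out (inr (2, 0)) _ pairing_open).
have outE x c k n j : Cantor.of_nat k = (n, j) ->
    proc (family p_ z_ rst src FA) x c (out k) =
    fstate p_ z_ rst src FA x c (Tp n Output j).
  by move=> kE; rewrite /out kE.
have mE : m = true \/ m = false by case: (m); [left|right].
have [mT|mF] := mE; last first.
  rewrite mF => x; split.
    move=> a; apply/negbTE/negP => ha; have [b _] := fstate_origin (p_ := p_) ha.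
    by rewrite /= mF.
  have [a _ ha] := pairing_cvg x; exists a => b /ha hb k.
  by case kE : Cantor.of_nat => [n j]; rewrite (outE _ _ _ _ _ kE); have [] := hb n.
rewrite mT => x; set S := fstate p_ z_ rst src FA x; split.
  have [a _ ha] := pairing_cvg x.
  have NH : S (osucc a) (aux 0 0) = false.
    rewrite /aux /S (@fstateS p_ z_ rst src FA x _ _ _ (osuccP a)); apply: asboolF => -[n].
    by have [_ ->] := ha a (ole_refl a) n; rewrite ?mT.
  exists (osucc (osucc a)).
  change (is_true (S (osucc (osucc a)) (inr (inr (2, 0))))).
  rewrite /S (@fstateS p_ z_ rst src FA x _ _ _ (osuccP _)) -/S; apply: asboolT.
  change (is_true [&& m, S (osucc a) fl0 || S (osucc a) fl1 & ~~ S (osucc a) (aux 0 0)]).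
  rewrite mT NH andbT andTb.
  have := at_zero_succ p_ z_ rst src FA x (osuccP a).
  by rewrite /at_zero -negb_or => /negbFE.
move=> a ha k; case kE : Cantor.of_nat => [n j]; rewrite (outE _ _ _ _ _ kE) -/S.
have [b ba hb] := @fstate_origin p_ z_ rst src FA _ _ _ ha.
have /and3P[_ bz bNH] : is_true [&& m, S b fl0 || S b fl1 & ~~ S b (aux 0 0)] by exact: hb.
have nz : ~ is_ozero b.
  by move=> b0; move: bz; rewrite /S /fl0 /fl1 !fstate0.
(* If some machine were running at each stage below [b], then [aux 0 0] would be 1 at [b]. *)
have [c cb cH] : exists2 c, olt c b & forall n, S c (Hb n).
  apply: contrapT => nc; move/negP: bNH; apply.
  have zb : olt ozero b.
    have [d db] := nzero_gt nz.
    by apply: ole_olt_trans db; exact: is_ozero_le is_ozeroP.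
  rewrite /S /aux (fstate_constF (v := true) zb) // => c _ cb; split=> // _.
  apply: contrapT => /forallNP hn; apply: nc; exists c => // n'.
  by apply/negPn/negP => /hn.
have ec : ole e c.
  have [//|] := ole_total e c; rewrite /e => /olt_osucc c0.
  have c0' : is_ozero c by move=> d dc; apply: (is_ozeroP (b := d)); apply: olt_ole_trans dc c0.
  by move: (cH 0); rewrite /S /Hb fstate0.
have ca : ole c a := oltW (olt_trans cb ba).
have [d cd [_ cHd]] := pairing_bits x n ec.
have [d' ad [aO _]] := pairing_bits x n (ole_trans ec ca).
have dd' : ole d d'.
  by apply: (@oadd_le_inv e); apply: ole_trans (proj2 cd) (ole_trans ca (proj1 ad)).
have hd : halted (run (p_ n) (z_ n) x d) by apply/haltedP; rewrite -cHd; exact: cH.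
have sx := pg n x; rewrite mT in sx.
by rewrite /S aO (halted_mono dd' hd) (settles_halted sx hd).
Qed.

End Pairing.

Lemma countable_pairing m (g : nat -> real -> real) :
  (forall n, computable m (g n)) ->
  computable m (fun x k => let: (n, j) := Cantor.of_nat k in g n x j).
Proof.
move=> cg; pose P n := cid (computable_settles (cg n)).
pose Z n := cid (projT2 (P n)).
exact: (@pairing_computable m g (fun n => projT1 (P n)) (fun n => projT1 (Z n))
  (fun n => projT2 (Z n))).
Qed.

(** * Composition *)

Section Composition.
Variables (m : bool) (f g : real -> real).
Variables (p_ : nat -> program) (z_ : nat -> real).
Hypothesis pf : forall x, settles m (p_ 0) (z_ 0) x (f x).
Hypothesis pg : forall x, settles m (p_ 1) (z_ 1) x (g x).

(* For [m = true], machine 1 is restarted until machine 0 has halted. For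
   [m = false], it is restarted on the stored copy [aux 2] of the output of
   machine 0 whenever that output was found to differ from the copy. *)
Let rst (n : nat) (u : nat + fbit -> bool) : bool :=
  if n is 0 then at_zero u else
  if m then ~~ u (aux 0 0) else u (aux 0 0) || at_zero u.
Let src (n : nat) (u : nat + fbit -> bool) : real := fun i =>
  if n is 0 then u (inl i) else
  if m then u (Tp 0 Output i) else u (aux 2 i).
Let FA (u : nat + fbit -> bool) (k j : nat) : Prop :=
  match k with
  | 0 => if m then is_true (u (Hb 0)) else exists i, u (Tp 0 Output i) != u (aux 2 i)
  | 1 => [&& m, u (aux 0 0) & u (Hb 1)]
  | _ => u (Tp 0 Output j)
  end.
Let out (k : nat) : fbit := inl (1, inl (inl (Output, k))).

Lemma composition_open i : opn ((family p_ z_ rst src FA)^~ i).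
Proof.
have az : cont (@at_zero).
  by apply: (cont_comp2 (fun a b => ~~ a && ~~ b)); exact: cont_bit.
apply: family_open => [n|n k|[|[|k]] j] //.
- rewrite /rst; case: n => // _; case: (m); first by apply: (cont_comp negb); exact: cont_bit.
  by apply: (cont_comp2 orb) => //; exact: cont_bit.
- by rewrite /src; case: n => [|_]; [|case: (m)]; exact: cont_bit.
- rewrite /FA; case: (m); first by apply: cont_opn; exact: cont_bit.
  apply: opn_ex => i'; apply: cont_opn.
  by apply: (cont_comp2 (fun a b => a != b)); exact: cont_bit.
- apply: cont_opn; apply: (cont_comp2 (fun a b => [&& m, a & b])); exact: cont_bit.
- by apply: cont_opn; exact: cont_bit.
Qed.

Section CompositionRun.
Variable x : real.
Local Notation S := (fstate p_ z_ rst src FA x).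
Let e0 := osucc ozero.

Lemma composition_bits0 c : ole e0 c -> exists2 d, oeq c (oadd e0 d) &
  (forall i, S c (Tp 0 Output i) = ctape (run (p_ 0) (z_ 0) x d) Output i) /\
  S c (Hb 0) = is_halt (cstate (run (p_ 0) (z_ 0) x d)).
Proof.
move=> ec; have o1 := osuccP ozero.
apply: (@family_bits p_ z_ rst src FA x 0 ozero e0 c o1) => //.
  exact: at_zero_zero is_ozeroP.
move=> c' ec'; apply: at_zeroP => /(_ ozero); apply.
exact: olt_ole_trans (olt_succ _) ec'.
Qed.

Lemma composition_cvg0 : exists2 a, ole e0 a & forall c, ole a c ->
  (forall i, S c (Tp 0 Output i) = f x i) /\ (m -> S c (Hb 0)).
Proof.
have [a aP] := pf x; exists (oadd e0 a); first exact: oadd_ge.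
move=> c ac; have [d cd [cO cH]] := composition_bits0 (ole_trans (oadd_ge e0 a) ac).
have [dO dH] := aP d (oadd_le_inv (ole_trans ac (proj1 cd))).
by split=> [i|/dH hd]; [rewrite cO dO|rewrite cH; apply/haltedP].
Qed.

(* Take [e] minimal: it is a successor stage [b + 1], and the copy of the output
   of machine 0 is correct at [b] and does not change from then on. *)
Lemma composition_eventual : m = false -> exists b e,
  [/\ is_osucc b e, rst 1 (S b), forall c, ole e c -> rst 1 (S c) = false &
      src 1 (S b) = f x].
Proof.
move=> mF; have [a0 ea0 ha0] := composition_cvg0.
have rE c : rst 1 (S c) = S c (aux 0 0) || at_zero (S c) by rewrite /rst mF.
have chg c : family p_ z_ rst src FA (S c) (inr (1, 0)) <->
    exists i, S c (Tp 0 Output i) != S c (aux 2 i) by rewrite /= mF.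
have Y c j : family p_ z_ rst src FA (S c) (inr (3, j)) <-> S c (Tp 0 Output j) by [].
have : exists e, forall c, ole e c -> rst 1 (S c) = false.
  exists (osucc (osucc a0)) => c ac.
  rewrite rE at_zeroP ?orbF; last first.
    by move=> c0; apply: (c0 (osucc a0)); apply: olt_ole_trans ac; exact: olt_succ.
  have ac' := olt_ole_trans (olt_succ _) ac.
  apply: (fstate_constF (v := false) ac') => b ab _; split=> // /chg[i].
  have a0b : olt a0 b := olt_ole_trans (olt_succ _) ab.
  have -> : S b (aux 2 i) = f x i.
    apply: (fstate_constF a0b) => b' ab' _; apply: iff_trans (Y b' i) _.
    by have [-> _] := ha0 b' ab'.
  by have [-> _] := ha0 b (oltW a0b); rewrite eqxx.
move=> /olt_ex_min[e er emin].
have [b sb] : exists b, is_osucc b e.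
  (* Stage 0 always restarts machine 1. If [e] were a limit, the difference bit would be 0 from some
     earlier stage on, against minimality. *)
  case: (ord_cases e) => [z|//|el].
    by have := er e (ole_refl e); rewrite rE at_zero_zero ?orbT.
  have := er e (ole_refl e); rewrite rE => /negbT; rewrite negb_or => /andP[+ _].
  rewrite /aux fstateL // => /asboolPn /existsNP[b /not_implyP[be nb]].
  have oe : olt (osucc b) e by exact: olimit_osucc.
  case: (emin _ oe) => c bc; have [ec|ce] := ole_total e c; first exact: er.
  rewrite rE at_zeroP ?orbF; last first.
    by move=> c0; apply: (c0 b); apply: olt_ole_trans bc; exact: olt_succ.
  apply/negbTE/negP => Sc; apply: nb; exists c; split=> //.
  exact: ole_trans (oltW (olt_succ _)) bc.
have be : olt b e by case: sb.
have rb : rst 1 (S b).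
  apply: contrapT => /negP /negbTE nr; apply: (emin b be) => c bc.
  have [cb|bc'] := ole_total c b; first by rewrite (fstate_oeq _ _ _ _ _ _ (conj cb bc)).
  by apply: er; apply: is_osucc_ole sb bc'.
(* No difference is recorded at [osucc c], so output and copy agree at [c]. Hence copying no longer
   changes the copy, and it is constant through limits too. *)
have OY c i : ole b c -> S c (Tp 0 Output i) = S c (aux 2 i).
  move=> bc; have : S (osucc c) (aux 0 0) = false.
    have ec : ole e (osucc c) by apply: is_osucc_ole sb _; exact/olt_osucc.
    by have := er _ ec; rewrite rE => /negbT; rewrite negb_or => /andP[/negbTE].
  rewrite {1}/aux (fstateS _ _ _ _ _ _ _ (osuccP c)) => /asboolPn nc.
  by apply/eqP/negPn/negP => ne; apply: nc; apply/chg; exists i.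
have YY c i : ole b c -> S c (aux 2 i) = S b (aux 2 i).
  elim/(well_founded_ind olt_wf): c => c IH bc.
  have [cb|bc'] := ole_total c b; first by rewrite (fstate_oeq _ _ _ _ _ _ (conj cb bc)).
  apply: (fstate_constF bc') => d bd dc; apply: iff_trans (Y d i) _.
  by rewrite OY // IH.
exists b, e; split=> //; apply/funext => i.
have -> : src 1 (S b) i = S b (aux 2 i) by rewrite /src mF.
have [c [ac bc]] : exists c, ole a0 c /\ ole b c.
  have [ab|/oltW ba] := ole_total a0 b.
    by exists b; split=> //; exact: ole_refl.
  by exists a0; split=> //; exact: ole_refl.
by rewrite -(YY c) // -OY //; have [-> _] := ha0 c ac.
Qed.

(** [aux 0 0] is [Hb 0] delayed by one step: just before its first 1, machine 0 has halted while
    machine 1 is still being restarted. The last clause rules out a premature halt, as the halting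
    bit requires [aux 0 0]. *)
Lemma composition_halting : m = true -> exists b e,
  [/\ is_osucc b e, rst 1 (S b), forall c, ole e c -> rst 1 (S c) = false,
      src 1 (S b) = f x & forall c, S c (aux 0 0) -> ole e c].
Proof.
move=> mT; have [a0 ea0 ha0] := composition_cvg0.
have Ph c : family p_ z_ rst src FA (S c) (inr (1, 0)) <-> S c (Hb 0) by rewrite /= mT.
have : exists e, S e (aux 0 0).
  exists (osucc a0); rewrite /aux (fstateS _ _ _ _ _ _ _ (osuccP a0)); apply/asboolP/Ph.
  by have [_ ->] := ha0 a0 (ole_refl a0).
move=> /olt_ex_min[e er emin].
have [b sb] : exists b, is_osucc b e.
  case: (ord_cases e) => [z|//|el]; first by move: er; rewrite /aux fstate0.
  have [[b0 be0] _] := el.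
  move: er; rewrite /aux fstateL // => /asboolP /(_ b0 be0)[c [_ ce Sc]].
  by case: (emin c ce).
have be : olt b e by case: sb.
have Hb0 : S b (Hb 0).
  by apply/Ph; move: er; rewrite /aux (fstateS _ _ _ _ _ _ _ sb) => /asboolP.
have eb : ole e0 b.
  have [//|/olt_osucc b0] := ole_total e0 b.
  have b0' : is_ozero b by move=> d db; apply: (is_ozeroP (b := d)); apply: olt_ole_trans db b0.
  by move: Hb0; rewrite /Hb fstate0.
have [d bd [bO bH]] := composition_bits0 eb.
have hd : halted (run (p_ 0) (z_ 0) x d) by apply/haltedP; rewrite -bH.
have sx := pf x; rewrite mT in sx.
have rE c : rst 1 (S c) = ~~ S c (aux 0 0) by rewrite /rst mT.
exists b, e; split=> //.
- by rewrite rE; apply/negP; exact: emin.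
- move=> c ec; rewrite rE; apply/negbF; have bc := olt_ole_trans be ec.
  apply: (fstate_constF bc) => c' bc' _; apply: iff_trans (Ph c') _.
  have [d' cd [_ ->]] := composition_bits0 (ole_trans eb bc'); split=> // _.
  have dd' : ole d d'.
    by apply: (@oadd_le_inv e0); apply: ole_trans (proj2 bd) (ole_trans bc' (proj1 cd)).
  by rewrite (halted_mono dd' hd); apply/haltedP.
- apply/funext => i; transitivity (S b (Tp 0 Output i)); first by rewrite /src mT.
  by rewrite bO (settles_halted sx hd).
- by move=> c Sc; have [//|ce] := ole_total e c; case: (emin c ce).
Qed.

End CompositionRun.

Lemma composition_computable : computable m (g \o f).
Proof.
apply: (@computable_process m _ _ out (inr (2, 0)) _ composition_open).
have mE : m = true \/ m = false by case: (m); [left|right].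
have hE x c : family p_ z_ rst src FA (fstate p_ z_ rst src FA x c) (inr (2, 0)) <->
  is_true [&& m, fstate p_ z_ rst src FA x c (aux 0 0) & fstate p_ z_ rst src FA x c (Hb 1)].
  by [].
have [mT|mF] := mE; last first.
  rewrite mF => x; split.
    move=> a; apply/negbTE/negP => ha; have [b _] := fstate_origin (p_ := p_) ha.
    by move=> /hE; rewrite mF.
  have [b [e [sb rb nr sE]]] := composition_eventual x mF.
  have [a aP] := pg (f x); exists (oadd e a) => c ac k.
  have [d cd [cO _]] := family_bits sb rb nr (ole_trans (oadd_ge e a) ac).
  have [dO _] := aP d (oadd_le_inv (ole_trans ac (proj1 cd))).
  by rewrite sE dO in cO; exact: cO.
rewrite mT => x; set S := fstate p_ z_ rst src FA x.
have [b [e [sb rb nr sE emin]]] := composition_halting x mT.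
have rE c : rst 1 (S c) = ~~ S c (aux 0 0) by rewrite /rst mT.
have sx := pg (f x); rewrite mT in sx; split.
  have [a aP] := sx.
  have [d cd [_ cH]] := family_bits sb rb nr (oadd_ge e a).
  have [_ hd] := aP d (oadd_le_inv (proj1 cd)).
  exists (osucc (oadd e a)).
  change (is_true (S (osucc (oadd e a)) (inr (inr (2, 0))))).
  rewrite /S (fstateS _ _ _ _ _ _ _ (osuccP _)); apply/asboolP/hE/and3P.
  split; first by rewrite mT.
    by have := nr _ (oadd_ge e a); rewrite rE => /negbFE.
  by rewrite cH sE; apply/haltedP/hd.
move=> a ha k; have [c ca] := @fstate_origin p_ z_ rst src FA _ _ _ ha.
move=> /hE /and3P[_ /emin ec cH].
have [d cd [_ cHd]] := family_bits sb rb nr ec.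
have ca' := oltW ca.
have [d' ad [aO _]] := family_bits sb rb nr (ole_trans ec ca').
have dd' : ole d d'.
  by apply: (@oadd_le_inv e); apply: ole_trans (proj2 cd) (ole_trans ca' (proj1 ad)).
rewrite sE in cHd aO.
have hd : halted (run (p_ 1) (z_ 1) (f x) d) by apply/haltedP; rewrite -cHd.
change (S a (Tp 1 Output k) = g (f x) k).
by rewrite /S aO (halted_mono dd' hd) (settles_halted sx hd).
Qed.

End Composition.

Lemma computable_comp m (f g : real -> real) :
  computable m f -> computable m g -> computable m (g \o f).
Proof.
move=> /computable_settles[p [z pf]] /computable_settles[q [y qg]].
exact: (@composition_computable m f g (fun n => if n is 0 then p else q)
  (fun n => if n is 0 then z else y)).
Qed.

(** * Enumerable equivalence relations *)

Lemma cont_computable m (g : real -> real) :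
  (forall k, cont (fun x : real => g x k)) -> computable m g.
Proof.
move=> cg; have -> : g = fun x k => `[< is_true (g x k) >].
  by apply/funext => x; apply/funext => k; rewrite asboolb.
by apply: open_computable => k; exact: cont_opn.
Qed.

Lemma decode_pair (s : nat -> real) n :
  decode (fun k => let: (n, j) := Cantor.of_nat k in s n j) n = s n.
Proof. by apply/funext => k; rewrite /decode Cantor.cancel_of_to. Qed.

Lemma decode_computable m n : computable m (decode^~ n).
Proof. by apply: cont_computable => k; exact: cont_bit. Qed.

Section Involutions.
Variable f : real -> real.

(** The Feldman-Moore involutions: [swap (n, n', i)] exchanges [x] and [y] when
    [y] is the [n]-th entry of [f x], [x] is the [n']-th entry of [f y], and the
    [i]-th bits of [x] and [y] are 0 and 1. The latter makes the domain disjoint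
    from the range. *)
Definition swaps (w : nat * nat * nat) (x y : real) : Prop :=
  [/\ decode (f x) w.1.1 = y, decode (f y) w.1.2 = x, x w.2 = false & y w.2 = true].

Definition swap (w : nat * nat * nat) (x : real) : real :=
  let y := decode (f x) w.1.1 in
  let y' := decode (f x) w.1.2 in
  if [&& ~~ x w.2, y w.2 & `[< decode (f y) w.1.2 = x >]] then y else
  if [&& x w.2, ~~ y' w.2 & `[< decode (f y') w.1.1 = x >]] then y' else x.

Lemma swapl w x y : swaps w x y -> swap w x = y.
Proof. by case=> xy yx x0 y1; rewrite /swap xy yx x0 y1 asboolT. Qed.

Lemma swapr w x y : swaps w x y -> swap w y = x.
Proof. by case=> xy yx x0 y1; rewrite /swap yx xy x0 y1 /= asboolT. Qed.

Variant swap_spec w x : real -> Prop :=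
  | SwapL y of swaps w x y : swap_spec w x y
  | SwapR y of swaps w y x : swap_spec w x y
  | SwapN : swap_spec w x x.

Lemma swapP w x : swap_spec w x (swap w x).
Proof.
rewrite /swap; case: ifP => [/and3P[/negbTE x0 y1 /asboolP e]|_].
  by apply: SwapL; split.
case: ifP => [/and3P[x1 /negbTE y0 /asboolP e]|_].
  by apply: SwapR; split.
exact: SwapN.
Qed.

Lemma swapK w : involutive (swap w).
Proof.
move=> x; case E : {1}(swap w x) / (swapP w x) => [y s|y s|//].
- exact: swapr s.
- exact: swapl s.
Qed.

(** The test [decode (f y) n' = x] is closed. A first map turns its negation, which is open, into a
    bit; a second one branches on that bit continuously. *)
Lemma swap_computable m w : computable m f -> computable m (swap w).
Proof.
move=> cf; case: w => [[n n'] i].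
have cid_ : computable m id by apply: cont_computable => k; exact: cont_bit.
have cd k : computable m (fun x => decode (f x) k).
  exact: (computable_comp cf (decode_computable m k)).
pose s (k : nat) (x : real) : real :=
  match k with
  | 0 => x
  | 1 => decode (f x) n
  | 2 => decode (f x) n'
  | 3 => decode (f (decode (f x) n)) n'
  | _ => decode (f (decode (f x) n')) n
  end.
have cs k : computable m (s k).
  case: k => [|[|[|[|k]]]]; [exact: cid_|exact: cd|exact: cd| |].
    exact: (computable_comp (cd n) (cd n')).
  exact: (computable_comp (cd n') (cd n)).
pose P (x : real) (k : nat) := let: (a, b) := Cantor.of_nat k in
  match a with
  | 0 | 1 | 2 => is_true (decode x a b)
  | _ => exists j, decode x a j != decode x 0 j
  end.
have cP : computable m (fun x k => `[< P x k >]).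
  apply: open_computable => k; rewrite /P; case: (Cantor.of_nat k) => a b.
  have ne a' : opn (fun x : real => exists j, decode x a' j != decode x 0 j).
    apply: opn_ex => j; apply: cont_opn.
    by apply: (cont_comp2 (fun a b : bool => a != b)); exact: cont_bit.
  by case: a => [|[|[|a]]] //; apply: cont_opn; exact: cont_bit.
(* [b 3 0] and [b 4 0] tell whether going forth and back misses [x]. *)
pose sel (b : nat -> nat -> bool) (k : nat) : bool :=
  if [&& ~~ b 0 i, b 1 i & ~~ b 3 0] then b 1 k else
  if [&& b 0 i, ~~ b 2 i & ~~ b 4 0] then b 2 k else b 0 k.
have csel : computable m (fun x k => sel (decode x) k).
  apply: cont_computable => k u.
  exists [seq Cantor.to_nat p | p <- [:: (0, i); (1, i); (2, i); (3, 0); (4, 0);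
    (0, k); (1, k); (2, k)]] => v uv.
  by rewrite /sel /decode !uv // !inE eqxx ?orbT.
have := computable_comp (computable_comp (countable_pairing cs) cP) csel.
congr computable; apply/funext => x; apply/funext => k /=.
set b := decode _.
have bE a j : b a j = `[< match a with
    | 0 | 1 | 2 => is_true (s a x j)
    | _ => exists j', s a x j' != x j'
    end >].
  rewrite /b /decode /P Cantor.cancel_of_to /decode.
  by case: a => [|[|[|a]]]; rewrite ?Cantor.cancel_of_to //; congr asbool;
    apply: eq_exists => j'; rewrite !Cantor.cancel_of_to.
have ne a : ~~ `[< exists j', s a x j' != x j' >] = `[< s a x = x >].
  rewrite -asbool_neg; apply: asbool_equiv_eq; split=> [h|-> [j]]; last by rewrite eqxx.
  by apply/funext => j; apply/eqP/negPn/negP => ne; apply: h; exists j.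
rewrite /sel !bE !asboolb (ne 3) (ne 4) /swap /=.
by case: ifP => // _; case: ifP.
Qed.

Definition word (w : seq (nat * nat * nat)) : real -> real :=
  foldr (fun a g => swap a \o g) id w.

Lemma word_cat s t : word (s ++ t) = word s \o word t.
Proof. by elim: s => //= a s ->. Qed.

Lemma word_rev s : cancel (word s) (word (rev s)).
Proof.
elim: s => // a s IH x; rewrite rev_cons -cats1 word_cat /=.
by rewrite swapK IH.
Qed.

Lemma word_computable m s : computable m f -> computable m (word s).
Proof.
move=> cf; elim: s => [|a s IH]; first by apply: cont_computable => k; exact: cont_bit.
exact: (computable_comp IH (swap_computable a cf)).
Qed.

Lemma word_group : is_bijection_group (range word).
Proof.
have K s : cancel (word (rev s)) (word s) by rewrite -{2}(revK s); exact: word_rev.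
split.
- by move=> _ [s _ <-]; exists (word (rev s)); [exact: word_rev|exact: K].
- by exists [::].
- by move=> _ _ [s _ <-] [t _ <-]; exists (s ++ t) => //; rewrite word_cat.
- move=> _ [s _ <-]; exists (word (rev s)); split; [by exists (rev s)|exact: word_rev|].
  exact: K.
Qed.

Variable E : real -> real -> Prop.
Hypotheses (hE : Equivalence E) (fE : enumerates f E).

Lemma enumerates_decode x n : E x (decode (f x) n).
Proof.
have -> : E x (decode (f x) n) = [set y | E x y] (decode (f x) n) by [].
by rewrite -fE; exists n.
Qed.

Lemma enumerates_index x y : E x y -> exists n, decode (f x) n = y.
Proof. by have -> : E x y = [set y | E x y] y by []; rewrite -fE => -[n _]; exists n. Qed.

Lemma word_orbit : E = orbit_rel (range word).
Proof.
apply/funext => x; apply/funext => y; apply/propext; split=> [xy|[_ [s _ <-] <-]].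
  have [->|ne] := pselect (x = y); first by exists id => //; exists [::].
  have yx : E y x by symmetry.
  have [n en] := enumerates_index xy; have [n' en'] := enumerates_index yx.
  have [i xi] : exists i, x i <> y i.
    by apply: contrapT => /forallNP h; apply: ne; apply/funext => i; have /contrapT := h i.
  case x0 : (x i) xi; case y0 : (y i) => // _.
    exists (word [:: (n', n, i)]); first by exists [:: (n', n, i)].
    by apply: swapr; split.
  exists (word [:: (n, n', i)]); first by exists [:: (n, n', i)].
  by apply: swapl; split.
elim: s x => [|a s IH] x /=; first by reflexivity.
transitivity (word s x); first exact: IH.
case: swapP => [v [<- _ _ _]|v [_ <- _ _]|]; try exact: enumerates_decode.
by reflexivity.
Qed.

End Involutions.

Theorem enumerable_iff m (E : real -> real -> Prop) : Equivalence E ->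
  (exists2 f, computable m f & enumerates f E) <->
  exists G : set (real -> real), [/\ is_bijection_group G, countable G,
    forall g, G g -> computable m g & E = orbit_rel G].
Proof.
move=> hE; split=> [[f cf fE]|[G [gG cG compG ->]]].
  exists (range (word f)); split.
  - exact: word_group.
  - exact: sub_countable (card_image_le _ _) (countableP _).
  - by move=> _ [s _ <-]; exact: word_computable.
  - exact: word_orbit.
have [c cinj] := countable_injP _ cG.
(* Indices outside the image of [c] get the identity, which also belongs to [G]. *)
have gex n : exists g, G g /\ ((exists2 g', G g' & c g' = n) -> c g = n).
  have [[g Gg cg]|nh] := pselect (exists2 g', G g' & c g' = n); first by exists g.
  by exists id; split=> //; exact: group_id.
pose g n := projT1 (cid (gex n)).
have gG' n : G (g n) by rewrite /g; case: cid => ? /= [].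
have gc h : G h -> g (c h) = h.
  move=> Gh; rewrite /g; case: cid => h' /= [Gh' e].
  by apply: cinj; rewrite ?inE //; apply: e; exists h.
exists (fun x k => let: (n, j) := Cantor.of_nat k in g n x j).
  by apply: countable_pairing => n; exact: compG.
move=> x; apply/seteqP; split=> [_ [n _ <-]|_ [h Gh <-]] /=.
  by rewrite (decode_pair (fun n => g n x)); exists (g n).
by exists (c h) => //; rewrite (decode_pair (fun n => g n x)) gc.
Qed.

Theorem theorem4p2 (E : real -> real -> Prop) (hE : Equivalence E) :
  (it_enumerable E <->
     exists G : set (real -> real),
       [/\ is_bijection_group G, countable G,
           forall g, G g -> it_computable g & E = orbit_rel G]) /\
  (it_eventually_enumerable E <->
     exists G : set (real -> real),
       [/\ is_bijection_group G, countable G,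
           forall g, G g -> it_eventually_computable g & E = orbit_rel G]).
Proof. by split; [exact: (enumerable_iff true hE)|exact: (enumerable_iff false hE)]. Qed.
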